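(* Let $a,b,k$ be positive integers with $b>2a-2$. Let $H$ be the complete $k$-partite graph $K_{b,\dots,b}$ (all $k$ parts of size $b$) and let $F$ be the complete $(k+1)$-partite graph $K_{1,a,\dots,a}$ (one part of size $1$ and $k$ parts of size $a$). Then $H$ is $F$-Tur\'an-good. Moreover, for $n$ large enough, every $n$-vertex $F$-free graph $G$ with $\mathcal{N}(H,G)=\mathrm{ex}(n,H,F)$ contains $T_k(n)$ as a subgraph.
   Context: For graphs $H,G$, $\mathcal{N}(H,G)$ denotes the number of subgraphs of $G$ isomorphic to $H$. For graphs $H,F$, $\mathrm{ex}(n,H,F)$ is the maximum of $\mathcal{N}(H,G)$ over all $F$-free graphs $G$ on $n$ vertices. The Tur\'an graph $T_{r}(n)$ is the complete $r$-partite graph on $n$ vertices whose part sizes are all $\lfloor n/r\rfloor$ or $\lceil n/r\rceil$. For a graph $F$ with chromatic number $\chi(F)\ge 2$, a graph $H$ is called $F$-Tur\'an-good if $H$ does not contain $F$ as a subgraph and $\mathrm{ex}(n,H,F)=\mathcal{N}(H,T_{\chi(F)-1}(n))$ for all sufficiently large $n$. *)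

(* Defs.v *)
From HB Require Import structures.
From mathcomp Require Import all_boot.

Set Implicit Arguments.
Unset Strict Implicit.
Unset Printing Implicit Defensive.

(* A simple graph on the vertex type V; an edge {x, y} is recorded by both     *)
(* ordered pairs (x, y) and (y, x), so sgraph V is a finite type in bijection  *)
(* with the simple graphs on V.                                                *)
Definition is_sgraph (V : finType) (E : {set V * V}) : bool :=
  [forall x, (x, x) \notin E] &&
  [forall x, forall y, ((x, y) \in E) == ((y, x) \in E)].

Record sgraph (V : finType) : Type :=
  SGraph { edge_set : {set V * V}; edge_setP : is_sgraph edge_set }.

HB.instance Definition _ (V : finType) := [isSub for @edge_set V].
HB.instance Definition _ (V : finType) := [Finite of sgraph V by <:].

Definition adj (V : finType) (G : sgraph V) : rel V :=
  fun x y => (x, y) \in edge_set G.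

Definition contains (V W : finType) (G : sgraph V) (F : sgraph W) : bool :=
  [exists f : {ffun W -> V}, injectiveb f &&
     [forall x, forall y, adj F x y ==> adj G (f x) (f y)]].

(* The pair S = (vertex set, edges) is a subgraph of G. Vertex sets are        *)
(* explicit because isolated vertices matter: a complete 1-partite graph is    *)
(* edgeless.                                                                   *)
Definition is_subgraph (V : finType) (G : sgraph V)
    (S : {set V} * sgraph V) : bool :=
  [forall x, forall y,
     adj S.2 x y ==> [&& x \in S.1, y \in S.1 & adj G x y]].

Definition subgraph_iso (V W : finType) (H : sgraph W)
    (S : {set V} * sgraph V) : bool :=
  [exists f : {ffun W -> V},
     [&& injectiveb f, [set f x | x : W] == S.1 &
         [forall x, forall y, adj H x y == adj S.2 (f x) (f y)]]].

Definition num_copies (V W : finType) (H : sgraph W) (G : sgraph V) : nat :=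
  #|[set S : {set V} * sgraph V | is_subgraph G S && subgraph_iso H S]|.

Definition ex (n : nat) (VH VF : finType) (H : sgraph VH) (F : sgraph VF)
    : nat :=
  \max_(G : sgraph 'I_n | ~~ contains G F) num_copies H G.

Definition colorable (V : finType) (G : sgraph V) (c : nat) : bool :=
  [exists f : {ffun V -> 'I_c}, forall x, forall y, adj G x y ==> (f x != f y)].

Lemma adj_irrefl (V : finType) (G : sgraph V) x : adj G x x = false.
Proof. by have /andP[/forallP/(_ x)/negbTE] := edge_setP G. Qed.

Lemma adj_sym (V : finType) (G : sgraph V) : symmetric (adj G).
Proof.
move=> x y; have /andP[_ /forallP/(_ x)/forallP/(_ y)/eqP] := edge_setP G.
by [].
Qed.

Lemma ex_colorable (V : finType) (G : sgraph V) : exists c, colorable G c.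
Proof.
exists #|V|; apply/existsP; exists [ffun x => enum_rank x].
apply/forallP => x; apply/forallP => y; apply/implyP => xy; rewrite !ffunE.
by apply: contraTneq xy => /enum_rank_inj ->; rewrite adj_irrefl.
Qed.

Definition chromatic_number (V : finType) (G : sgraph V) : nat :=
  ex_minn (ex_colorable G).

(* Complete m-partite graph whose i-th part has size s i: vertices are pairs   *)
(* (part, position in the part), adjacent when the parts differ.               *)
Definition multipartite_edges (m : nat) (s : 'I_m -> nat)
    : {set {i : 'I_m & 'I_(s i)} * {i : 'I_m & 'I_(s i)}} :=
  [set p | tag p.1 != tag p.2].

Fact multipartite_is_sgraph m (s : 'I_m -> nat) :
  is_sgraph (multipartite_edges s).
Proof.
apply/andP; split; apply/forallP => x; first by rewrite inE eqxx.
by apply/forallP => y; rewrite !inE /= (eq_sym (tag x)).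
Qed.

Definition complete_multipartite (m : nat) (s : 'I_m -> nat)
    : sgraph {i : 'I_m & 'I_(s i)} :=
  SGraph (multipartite_is_sgraph s).

(* The first n %% r parts have size ceil(n / r), the others floor(n / r).      *)
Definition turan_part (r n : nat) (i : 'I_r) : nat := n %/ r + (i < n %% r).

Definition turan_graph (r n : nat) := complete_multipartite (@turan_part r n).

Lemma card_turan (r n : nat) : 0 < r ->
  #|{: {i : 'I_r & 'I_(turan_part n i)}}| = n.
Proof.
move=> r0; rewrite card_tagged sumnE big_map big_enum /=.
under eq_bigr do rewrite card_ord.
rewrite big_split /= sum_nat_const card_ord [RHS](divn_eq n r) mulnC.
congr (_ + _); transitivity (\sum_(i < r | i < n %% r) 1).
  by rewrite [RHS]big_mkcond; apply: eq_bigr => i _; case: ltnP.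
by rewrite (big_ord_narrow (ltnW (ltn_pmod n r0))) sum1_card card_ord.
Qed.

(* The Turan-good property is only defined for F with chromatic number at      *)
(* least 2, whence the first conjunct.                                         *)
Definition turan_good (VH VF : finType) (H : sgraph VH) (F : sgraph VF)
    : Prop :=
  [/\ 2 <= chromatic_number F,
      ~~ contains H F &
      exists n0, forall n, n0 <= n ->
        ex n H F = num_copies H (turan_graph (chromatic_number F - 1) n)].

(* Main.v *)
Require Import Defs.
From mathcomp Require Import all_boot all_order all_fingroup all_algebra.
From mathcomp Require Import zify ring lra.

(* If every vertex of G has fewer than a neighbours in its own class of some
   k-colouring of the vertices, then b > 2a-2 forces each part of a copy of
   H = K_k(b) to fill exactly one class: a class meeting two parts of the copy
   contains at most 2(a-1) < b of its vertices. Hence copies of H use only edges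
   between classes, and their number is at most that of the complete k-partite
   graph on the classes, which is largest for balanced classes.

   Such a colouring exists when G is large, F-free, and has minimum degree at
   least (1 - 1/k - eps)n: fix a large K_k(t) in G; by F-freeness each vertex has
   fewer than a neighbours in one of its k parts, and this part is its colour, up
   to moving the few vertices that miss many vertices of another part.

   The minimum degree comes from the number of copies of H at a vertex v. The
   neighbourhood N(v) has no K_k(a), hence o(n^k) k-cliques, so by Moon and Moser
   about (d(v)/(k-1))^(k-1) cliques of size k-1 at most. A k-clique through v
   extends to a copy of H in at most about (n/k)^(k(b-1)) ways by the AM-GM
   inequality. So a vertex lying in as many copies as the increment of the
   Turan count has degree at least (1 - 1/k - eps)n.

   Vertices lying in fewer copies are deleted one by one; each deletion gains at
   least one copy over the Turan count, so for large n none is possible. *)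

Set Implicit Arguments.
Unset Strict Implicit.
Unset Printing Implicit Defensive.

(** * Cliques and codegrees *)

(** Doubling both sides gives sums over pairs (i, j), where 2 d_i d_j <= d_i^2 + d_j^2 holds
    termwise. *)
Lemma nat_Cauchy_Schwarz (I : finType) (A : {pred I}) (d : I -> nat) :
  (\sum_(i in A) d i) ^ 2 <= #|A| * \sum_(i in A) d i ^ 2.
Proof.
have E : 2 * (#|A| * \sum_(i in A) d i ^ 2)
    = \sum_(i in A) \sum_(j in A) (d i ^ 2 + d j ^ 2).
  under [RHS]eq_bigr do rewrite big_split sum_nat_const.
  by rewrite big_split /= sum_nat_const -big_distrr /= mul2n -addnn.
rewrite -(leq_pmul2l (isT : 0 < 2)) E.
rewrite expnS expn1 big_distrlr big_distrr /=; apply: leq_sum => i _.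
by rewrite big_distrr; apply: leq_sum => j _; apply: nat_Cauchy.
Qed.

Lemma leq_expn2r m n j : m <= n -> m ^ j <= n ^ j.
Proof. by case: j => // j mn; rewrite leq_exp2r. Qed.

Lemma leq_ffact_expn n m : n ^_ m <= n ^ m.
Proof.
elim: m => [|m IH]; first by rewrite ffactn0.
by rewrite ffactnSr expnSr leq_mul // leq_subr.
Qed.

Lemma leq_expn_ffact n m : (n - m) ^ m <= n ^_ m.
Proof.
elim: m => [|m IH]; first by rewrite ffactn0.
rewrite ffactnSr expnSr; apply: leq_mul; last by lia.
by apply: leq_trans IH; apply: leq_expn2r; lia.
Qed.

Section Cliques.

Variables (V : finType) (e : rel V).
Hypotheses (e_sym : symmetric e) (e_irr : irreflexive e).
Implicit Types (S X Z : {set V}) (v w x y : V).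

Definition clique Z := [forall x in Z, forall y in Z, (x != y) ==> e x y].

Definition cliques S j :=
  [set Z : {set V} | [&& Z \subset S, #|Z| == j & clique Z]].

Definition cnbhd Z := [set w | [forall z in Z, e z w]].

Definition complete_family k (T : 'I_k -> {set V}) :=
  forall i j, i != j -> forall x y, x \in T i -> y \in T j -> e x y.

Lemma cliqueP Z :
  reflect {in Z &, forall x y, x != y -> e x y} (clique Z).
Proof.
apply: (iffP forall_inP) => [h x y xZ yZ xy|h x xZ].
  by have /forall_inP/(_ y yZ)/implyP/(_ xy) := h x xZ.
by apply/forall_inP => y yZ; apply/implyP; apply: h.
Qed.

Lemma cnbhdP Z w : reflect {in Z, forall z, e z w} (w \in cnbhd Z).
Proof. by rewrite inE; apply: forall_inP. Qed.

Lemma cnbhd_notin Z w : w \in cnbhd Z -> w \notin Z.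
Proof. by move/cnbhdP => h; apply/negP => /h; rewrite e_irr. Qed.

Lemma clique_setU1 Z w : w \notin Z ->
  clique (w |: Z) = clique Z && (w \in cnbhd Z).
Proof.
move=> wZ; apply/cliqueP/andP => [h|[/cliqueP hZ /cnbhdP hw] x y].
  split; first by apply/cliqueP => x y xZ yZ; apply: h; rewrite !inE ?xZ ?yZ orbT.
  apply/cnbhdP => z zZ; apply: h; rewrite ?inE ?zZ ?orbT ?eqxx //.
  by apply: contraNneq wZ => <-.
rewrite !inE => /orP[/eqP->|xZ] /orP[/eqP->|yZ]; rewrite ?eqxx //.
- by move=> _; rewrite e_sym; apply: hw.
- by move=> _; apply: hw.
- exact: hZ.
Qed.

(** The pair (X, y) corresponds to (Z, w) = (X - y, y). Leaving the weight [h] free lets one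
    bijection give both the sum of the codegrees and the sum of their squares. *)
Lemma sum_clique_ext S j (h : {set V} -> V -> nat) :
  \sum_(X in cliques S j.+1) \sum_(y in X) h X y =
  \sum_(Z in cliques S j) \sum_(w in S :&: cnbhd Z) h (w |: Z) w.
Proof.
rewrite !pair_big_dep /=.
rewrite (reindex_onto (fun p => (p.2 |: p.1, p.2)) (fun p => (p.1 :\ p.2, p.2)));
  last by case=> X y /= /andP[_ yX]; rewrite setD1K.
apply: eq_bigl => -[Z w] /=; rewrite xpair_eqE eqxx andbT setU11 andbT.
have [wZ|wZ] := boolP (w \in Z).
  have -> : (w |: Z) :\ w == Z = false.
    by apply/eqP => /setP/(_ w); rewrite !inE eqxx wZ.
  rewrite andbF !inE; symmetry; apply: contraTF wZ => /andP[_ /andP[_ hw]].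
  by apply: cnbhd_notin; rewrite inE.
rewrite setU1K // eqxx andbT in_setI [LHS]inE [Z \in _]inE.
rewrite subUset sub1set cardsU1 wZ add1n eqSS clique_setU1 //.
by case: (w \in S); case: (Z \subset S); case: (_ == j); case: (clique Z).
Qed.

Lemma sum_codegree S j :
  \sum_(Z in cliques S j) #|S :&: cnbhd Z| = j.+1 * #|cliques S j.+1|.
Proof.
under eq_bigr do rewrite -sum1_card.
rewrite -(sum_clique_ext S j (fun _ _ => 1)) mulnC -sum_nat_const.
by apply: eq_bigr => X; rewrite sum1_card inE => /and3P[_ /eqP].
Qed.

(** A vertex of S adjacent to all of X is counted |X| times. A vertex missing some z in X can only
    be counted for y = z, hence at most once. *)
Lemma sum_cnbhd_clique S X :
  \sum_(y in X) #|S :&: cnbhd (X :\ y)|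
    <= #|S| + #|X|.-1 * #|S :&: cnbhd X|.
Proof.
have cardI (A B : {set V}) : #|A :&: B| = \sum_(w in A) (w \in B).
  rewrite -sum1_card big_mkcond [RHS]big_mkcond /=; apply: eq_bigr => w _.
  by rewrite inE; case: (w \in A); case: (w \in B).
under eq_bigr do rewrite cardI.
rewrite exchange_big /= cardI -sum1_card big_distrr -big_split /=.
apply: leq_sum => w _; have [/cnbhdP wX|] := boolP (w \in cnbhd X).
  apply: (@leq_trans (\sum_(y in X) 1)); first by apply: leq_sum => y _; exact: leq_b1.
  by rewrite sum1_card muln1 add1n; lia.
rewrite inE negb_forall => /existsP[z]; rewrite negb_imply => /andP[zX ezw].
rewrite muln0 addn0 (bigD1 z) //= big1 => [|y /andP[yX yz]].
  by rewrite addn0 leq_b1.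
apply/eqP; rewrite eqb0; apply: contra ezw => /cnbhdP; apply.
by rewrite !inE eq_sym yz.
Qed.

(** Cauchy-Schwarz is applied to the codegrees of the j-cliques. Their squares sum to the codegrees
    of X - y over all (j+1)-cliques X and y in X, which [sum_cnbhd_clique] bounds. *)
Lemma Moon_Moser S j :
  (j.+1 * #|cliques S j.+1|) ^ 2 <=
  #|cliques S j| * (#|S| * #|cliques S j.+1| + j * (j.+2 * #|cliques S j.+2|)).
Proof.
rewrite -sum_codegree; apply: leq_trans (nat_Cauchy_Schwarz _ _) _.
rewrite leq_mul2l; apply/orP; right.
have -> : \sum_(Z in cliques S j) #|S :&: cnbhd Z| ^ 2
   = \sum_(X in cliques S j.+1) \sum_(y in X) #|S :&: cnbhd (X :\ y)|.
  rewrite (sum_clique_ext S j (fun X y => #|S :&: cnbhd (X :\ y)|)).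
  apply: eq_bigr => Z _; rewrite expnS expn1 -sum_nat_const.
  apply: eq_bigr => w; rewrite inE => /andP[_ /cnbhd_notin wZ].
  by rewrite setU1K.
rewrite -sum_codegree big_distrr mulnC -sum_nat_const -big_split /=.
apply: leq_sum => X; rewrite inE => /and3P[_ /eqP cX _].
by apply: leq_trans (sum_cnbhd_clique _ _) _; rewrite cX.
Qed.

Lemma card_cliques S j n : #|S| <= n -> #|cliques S j| <= n ^ j.
Proof.
move=> Sn; apply: (@leq_trans 'C(#|S|, j)).
  rewrite -cards_draws; apply: subset_leq_card; apply/subsetP => Z.
  by rewrite !inE => /and3P[-> ->].
apply: (@leq_trans (#|S| ^_ j)); last exact: leq_trans (leq_ffact_expn _ _) (leq_expn2r _ Sn).
by rewrite -bin_ffact leq_pmulr ?fact_gt0.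
Qed.

(* Counting the pairs (Z, A) with A an a-set of common neighbours of the clique Z. *)
Lemma dense_common_cliques a k C n S : 0 < n -> 0 < C -> 4 * C * a <= n -> #|S| <= n ->
  n ^ k.+1 <= C * #|cliques S k.+1| ->
  exists A : {set V}, [/\ A \subset S, #|A| = a &
    n ^ k <= 2 * C * (4 * C) ^ a * #|cliques (S :&: cnbhd A) k|].
Proof.
move=> n0 C0 an Sn dense; set C' := 2 * C * (4 * C) ^ a.
pose d (Z : {set V}) := #|S :&: cnbhd Z|.
(* Heavy cliques have codegree at least n/(2C). The light ones account for at most half of the total
   n^(k+1)/C that density forces. *)
pose heavy := [set Z in cliques S k | n <= 2 * C * d Z].
have dn Z : d Z <= n by apply: leq_trans (subset_leq_card (subsetIl _ _)) Sn.
have heavy_many : n ^ k <= 2 * C * #|heavy|.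
  have : n ^ k.+1 <= C * \sum_(Z in cliques S k) d Z.
    by apply: leq_trans dense _; rewrite sum_codegree leq_mul2l leq_pmull ?orbT.
  rewrite (bigID (fun Z => n <= 2 * C * d Z)) /=.
  have h1 : \sum_(Z in cliques S k | n <= 2 * C * d Z) d Z <= #|heavy| * n.
    rewrite -sum_nat_const (eq_bigl (mem heavy)) => [|Z]; last by rewrite !inE.
    exact: leq_sum.
  have h2 : 2 * C * (\sum_(Z in cliques S k | ~~ (n <= 2 * C * d Z)) d Z) <= n ^ k * n.
    rewrite big_distrr; apply: (@leq_trans (\sum_(Z in cliques S k) n)).
      rewrite big_mkcondr; apply: leq_sum => Z _ /=.
      by case: (leqP n (2 * C * d Z)) => //= /ltnW.
    by rewrite sum_nat_const leq_mul2r card_cliques ?orbT.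
  move: h1 h2; set s1 := \sum_(Z in _ | _ <= _) _; set s2 := \sum_(Z in _ | ~~ _) _.
  rewrite mulnDr expnSr => h1 h2 h3; rewrite -(leq_pmul2r n0).
  have h4 := leq_mul (leqnn C) h1.
  rewrite -!mulnA in h2 h4 *.
  move: (C * s1) (C * s2) (C * (#|heavy| * n)) (n ^ k * n) h2 h3 h4 => *.
  lia.
pose F (A : {set V}) := #|[set Z in cliques S k | A \subset cnbhd Z]|.
have count : n ^ (a + k) <= C' * \sum_(A : {set V} | (A \subset S) && (#|A| == a)) a`! * F A.
  rewrite -big_distrr.
  have -> : \sum_(A : {set V} | (A \subset S) && (#|A| == a)) F A
      = \sum_(Z in cliques S k) 'C(d Z, a).
    have FE A : F A = \sum_(Z in cliques S k) (A \subset cnbhd Z).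
      rewrite /F -sum1_card big_mkcond [RHS]big_mkcond; apply: eq_bigr => Z _ /=.
      by rewrite inE; case: (Z \in _); case: (_ \subset _).
    rewrite (eq_bigr _ (fun A _ => FE A)) exchange_big /=; apply: eq_bigr => Z _.
    rewrite -cards_draws -sum1_card big_mkcond [RHS]big_mkcond; apply: eq_bigr => A _ /=.
    by rewrite inE subsetI; case: (A \subset S); case: (_ \subset _); case: (_ == _).
  (* Here d Z - a >= n/(4C), because d Z >= n/(2C) and a <= n/(4C). *)
  have hZ Z : Z \in heavy -> n ^ a <= (4 * C) ^ a * (a`! * 'C(d Z, a)).
    rewrite inE => /andP[_ hd]; rewrite [a`! * _]mulnC bin_ffact.
    apply: leq_trans (leq_mul (leqnn _) (leq_expn_ffact _ _)).
    rewrite -expnMn; apply: leq_expn2r; nia.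
  rewrite expnD /C'; apply: leq_trans (leq_mul (leqnn _) heavy_many) _.
  have : #|heavy| * n ^ a <= (4 * C) ^ a * (a`! * \sum_(Z in cliques S k) 'C(d Z, a)).
    rewrite -sum_nat_const big_distrr big_distrr /=.
    apply: (@leq_trans (\sum_(Z in heavy) (4 * C) ^ a * (a`! * 'C(d Z, a)))).
      exact: leq_sum.
    rewrite [X in _ <= X](bigID (mem heavy)) /= -[X in X <= _]addn0 leq_add //.
    by apply/eq_leq/eq_bigl => Z /=; rewrite in_set; case: (Z \in _).
  by move=> h; rewrite mulnC -!mulnA !leq_mul2l; move: h; rewrite mulnC => ->; rewrite !orbT.
(* Averaging: S has at most n^a / a! subsets of size a, so by [count] not all of them can have F A <
   n^k / C'. *)
have [A /and3P[AS Aa hA]|no] := pickP (fun A : {set V} =>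
    [&& A \subset S, #|A| == a & n ^ k <= C' * F A]).
  exists A; split=> //; first exact/eqP.
  apply: leq_trans hA _; rewrite leq_mul2l; apply/orP; right.
  apply: subset_leq_card; apply/subsetP => Z; rewrite !inE => /andP[/and3P[ZS -> ->] /subsetP h].
  rewrite !andbT subsetI ZS; apply/subsetP => z zZ; apply/cnbhdP => y yA.
  by rewrite e_sym; move/cnbhdP: (h _ yA); apply.
have [A0 A0p|none] := pickP (fun A : {set V} => (A \subset S) && (#|A| == a)); last first.
  by move: count; rewrite big_pred0 // muln0 leqNgt expn_gt0 n0.
suff : C' * \sum_(A : {set V} | (A \subset S) && (#|A| == a)) a`! * F A < n ^ (a + k).
  by rewrite ltnNge count.
rewrite big_distrr /=.
apply: (@leq_trans (\sum_(A : {set V} | (A \subset S) && (#|A| == a)) a`! * n ^ k)).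
  have lt (A : {set V}) : (A \subset S) && (#|A| == a) -> C' * (a`! * F A) < a`! * n ^ k.
    move=> /andP[h1 h2]; have := no A; rewrite h1 h2 /= => /negbT; rewrite -ltnNge.
    by rewrite mulnCA ltn_pmul2l ?fact_gt0.
  rewrite (bigD1 A0) //= [X in _ < X](bigD1 A0) //= -addSn leq_add ?lt //.
  by apply: leq_sum => A /andP[/lt/ltnW].
rewrite sum_nat_cond_const mulnA expnD leq_mul2r; apply/orP; right.
rewrite cards_draws bin_ffact.
exact: leq_trans (leq_ffact_expn _ _) (leq_expn2r _ Sn).
Qed.

End Cliques.

(** Induction on k: [dense_common_cliques] yields the first part A, and the k-cliques in its common
    neighbourhood stay dense with a larger constant. Density is measured against a fixed n >= |S|,
    so that it survives shrinking S. *)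
Lemma dense_cliques_complete_family a k C : 0 < C ->
  exists n0, forall (V : finType) (e : rel V) (S : {set V}) n,
    symmetric e -> irreflexive e -> n0 <= n -> #|S| <= n ->
    n ^ k <= C * #|cliques e S k| ->
  exists T : 'I_k -> {set V},
    [/\ complete_family e T, forall i, T i \subset S & forall i, #|T i| = a].
Proof.
elim: k C => [|k IH] C C0.
  by exists 0 => V e S n _ _ _ _ _; exists (fun=> set0); split=> [[]|[]|[]].
have C'0 : 0 < 2 * C * (4 * C) ^ a by rewrite !muln_gt0 C0 expn_gt0 muln_gt0 C0.
have [n0 hn0] := IH _ C'0; exists (maxn n0 (maxn 1 (4 * C * a))) => V e S n e_sym e_irr.
rewrite !geq_max => /and3P[n0n n_gt0 an] Sn dense.
have [A [AS Aa hA]] := dense_common_cliques e_sym e_irr n_gt0 C0 an Sn dense.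
have S'n : #|S :&: cnbhd e A| <= n by apply: leq_trans (subset_leq_card (subsetIl _ _)) Sn.
have [T [Tc TS Ta]] := hn0 V e _ n e_sym e_irr n0n S'n hA.
exists (fun i => if unlift ord0 i is Some j then T j else A).
have TN j x y : x \in T j -> y \in A -> e y x.
  move=> /(subsetP (TS j)); rewrite inE => /andP[_ /cnbhdP h] /h //.
split=> [i i'|i|i]; last 2 first.
- by case: unliftP => // j _; apply: subset_trans (TS j) (subsetIl _ _).
- by case: unliftP.
case: unliftP => [j|] ->; case: unliftP => [j'|] -> //.
- by rewrite (inj_eq (lift_inj (h:=_))) => /Tc; apply.
- by move=> _ x y xT yA; rewrite e_sym (TN j).
- by move=> _ x y xT yA; rewrite (TN j').
Qed.

(** * From minimum degree to a colouring *)

Section Colouring.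

Variables (V : finType) (e : rel V).
Hypotheses (e_sym : symmetric e) (e_irr : irreflexive e).
Implicit Types (S X Z A : {set V}) (v w x y : V).

Definition nbhd v := [set w | e v w].

(* The graph contains no K_{1,a,...,a} with k parts of size a. *)
Definition join_free a k := forall v (T : 'I_k -> {set V}),
  complete_family e T -> (forall i, T i \subset nbhd v) ->
  (forall i, #|T i| = a) -> False.

Lemma subset_of_card S m : m <= #|S| -> exists2 A : {set V}, A \subset S & #|A| = m.
Proof.
move=> mS; have : 0 < 'C(#|S|, m) by rewrite bin_gt0.
rewrite -cards_draws => /card_gt0P[A]; rewrite inE => /andP[AS /eqP Am].
by exists A.
Qed.

Lemma card_bigcup_seq (I : eqType) (s : seq I) (F : I -> {set V}) m :
  {in s, forall i, #|F i| <= m} -> #|\bigcup_(i <- s) F i| <= size s * m.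
Proof.
elim: s => [|i s IH] h; first by rewrite big_nil cards0.
rewrite big_cons mulSn cardsU; apply: leq_trans (leq_subr _ _) (leq_add _ _).
  exact/h/mem_head.
by apply: IH => j js; rewrite h // inE js orbT.
Qed.

Lemma card_setD_cnbhd S Z m : {in Z, forall z, #|S :\: nbhd z| <= m} ->
  #|S :\: cnbhd e Z| <= #|Z| * m.
Proof.
move=> h; apply: (@leq_trans #|\bigcup_(z <- enum Z) (S :\: nbhd z)|); last first.
  by rewrite [#|Z|]cardE; apply: card_bigcup_seq => z; rewrite mem_enum; apply: h.
rewrite big_enum; apply: subset_leq_card; apply/subsetP => w; rewrite inE => /andP[hw wS].
move: hw; rewrite inE negb_forall => /existsP[z]; rewrite negb_imply => /andP[zZ zw].
by apply/bigcupP; exists z => //; rewrite !inE zw.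
Qed.

(** Each new part is taken from the common neighbourhood of the parts chosen before; these have at
    most [size s * a] vertices, each of which excludes at most m candidates. Indexing by a list
    allows one colour to be left out later. *)
Lemma greedy_complete_family k (S : 'I_k -> {set V}) a m (s : seq 'I_k) :
  uniq s -> {in s, forall i, a + size s * a * m <= #|S i|} ->
  {in s &, forall i j, i != j -> {in S i, forall x, #|S j :\: nbhd x| <= m}} ->
  exists T : 'I_k -> {set V},
    {in s, forall i, T i \subset S i /\ #|T i| = a} /\
    {in s &, forall i j, i != j -> forall x y, x \in T i -> y \in T j -> e x y}.
Proof.
elim: s => [|i s IH] /=; first by exists (fun=> set0); split.
case/andP=> is_ us hL hM.
have [|j j' js j's|T [TS Tc]] := IH us.
- move=> j js; apply: leq_trans (hL j _); last by rewrite inE js orbT.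
  by rewrite mulSn; nia.
- by apply: hM; rewrite inE ?js ?j's orbT.
pose B := \bigcup_(j <- s) T j.
have BP w : w \in B -> exists2 j, j \in s & w \in T j.
  by rewrite /B big_tnth => /bigcupP[j _ wj]; exists (tnth (in_tuple s) j); rewrite ?mem_tnth.
have cardB : #|B| <= size s * a.
  by apply: card_bigcup_seq => j js; rewrite (TS _ js).2.
have hB : #|S i :\: cnbhd e B| <= #|B| * m.
  apply: card_setD_cnbhd => z /BP[j js /(subsetP (TS _ js).1) zS].
  apply: hM zS; rewrite ?inE ?js ?eqxx ?orbT //.
  by apply: contraNneq is_ => <-.
have [|A AS Aa] := @subset_of_card (S i :&: cnbhd e B) a.
  have := hL i (mem_head _ _); rewrite -(cardsID (cnbhd e B) (S i)); nia.
have AB w z : w \in A -> z \in B -> e z w.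
  by move=> /(subsetP AS); rewrite inE => /andP[_ /cnbhdP]; apply.
have TB j w : j \in s -> w \in T j -> w \in B.
  by move=> js wj; rewrite /B (big_rem j) //= inE wj.
exists (fun j => if j == i then A else T j); split=> [j|j j'].
  rewrite inE; have [-> _|_ /= /TS//] := eqVneq j i; split=> //.
  exact: subset_trans AS (subsetIl _ _).
rewrite !inE; case: (eqVneq j i) => [->|ji] /=; case: (eqVneq j' i) => [->|j'i] //=.
- by move=> _ j's _ x y xA yT; rewrite e_sym AB // (TB j').
- by move=> js _ _ x y xT yA; rewrite AB // (TB j).
- exact: Tc.
Qed.

Section JoinFree.

Variables (a k : nat).
Hypothesis Ffree : join_free a k.

Lemma join_free_large v (T : 'I_k -> {set V}) :
  complete_family e T -> (forall i, T i \subset nbhd v) ->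
  exists i, #|T i| < a.
Proof.
move=> Tc Tv; apply/existsP; apply: contraT; rewrite negb_exists => /forallP h.
have ex i : exists A : {set V}, (A \subset T i) && (#|A| == a).
  have [|A AT /eqP Aa] := @subset_of_card (T i) a; first by rewrite leqNgt.
  by exists A; rewrite AT.
case: (Ffree (v := v) (T := fun i => xchoose (ex i))) => [i j ij x y|i|i].
- have /andP[/subsetP hi _] := xchooseP (ex i).
  have /andP[/subsetP hj _] := xchooseP (ex j).
  by move=> /hi xi /hj yj; apply: Tc xi yj.
- by have /andP[hi _] := xchooseP (ex i); apply: subset_trans hi (Tv i).
- by have /andP[_ /eqP] := xchooseP (ex i).
Qed.

(** If v had a set A of a neighbours in X, then T = A + v would have a+1 vertices, and A in position
    i with the sets R j in the other positions would form a complete family inside the neighbourhood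
    of v. *)
Lemma inner_degree_lt v i X : v \in X ->
  (forall T : {set V}, T \subset X -> #|T| = a.+1 ->
    exists R : 'I_k -> {set V}, forall j, j != i ->
      [/\ R j \subset cnbhd e T, a <= #|R j| &
          forall j', j' != i -> j != j' ->
            forall x y, x \in R j -> y \in R j' -> e x y]) ->
  #|X :&: nbhd v| < a.
Proof.
move=> vX hR; rewrite ltnNge; apply/negP => /subset_of_card[A].
rewrite subsetI => /andP[AX Av] Aa.
have vA : v \notin A by apply/negP => /(subsetP Av); rewrite inE e_irr.
have [||R hRR] := hR (v |: A).
- by rewrite subUset sub1set vX.
- by rewrite cardsU1 vA Aa.
have RA j x y : j != i -> x \in R j -> y \in v |: A -> e y x.
  by case/hRR=> /subsetP h _ _ /h /cnbhdP; apply.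
have [||j] := @join_free_large v (fun j => if j == i then A else R j).
- move=> j j'; case: (eqVneq j i) => [->|ji]; case: (eqVneq j' i) => [_|j'i] //=.
  + by move=> _ x y xA yR; rewrite (RA j') // !inE xA orbT.
  + by move=> _ x y xR yA; rewrite e_sym (RA j) // !inE yA orbT.
  + by move=> jj' x y xR yR; case: (hRR j ji) => _ _ h; exact: (h j' j'i jj').
- move=> j; case: eqVneq => // ji; apply/subsetP => x xR.
  by rewrite inE (RA j) // setU11.
- case: eqVneq => [_|ji]; first by rewrite Aa ltnn.
  by case: (hRR j ji) => _ h _; rewrite ltnNge h.
Qed.

End JoinFree.

(** Fewer than k vertices together miss at most (k-1)(n/k + m) vertices, which leaves at least
    n/(2k) common neighbours, so cliques can be extended one vertex at a time. *)
Lemma clique_density k m : 0 < k ->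
  (forall v, k * (#|V| - #|nbhd v|) <= #|V| + k * m) -> 2 * k ^ 2 * m <= #|V| ->
  #|V| ^ k <= (2 * k ^ 2) ^ k * #|cliques e [set: V] k|.
Proof.
move=> k0 deg hm.
suff: forall j, j <= k -> #|V| ^ j <= (2 * k ^ 2) ^ j * #|cliques e [set: V] j| by apply.
elim=> [_|j IH jk].
  rewrite mul1n card_gt0; apply/set0Pn; exists set0.
  by rewrite !inE sub0set cards0 eqxx; apply/cliqueP => x; rewrite inE.
have h : #|V| * #|cliques e [set: V] j| <= 2 * k * (j.+1 * #|cliques e [set: V] j.+1|).
  rewrite -(sum_codegree e_sym e_irr) mulnC -sum_nat_const big_distrr /=.
  apply: leq_sum => Z; rewrite inE => /and3P[_ /eqP cZ _]; rewrite setTI.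
  have : k * #|[set: V] :\: cnbhd e Z| <= j * (#|V| + k * m).
    have kd z : #|[set: V] :\: nbhd z| <= (#|V| + k * m) %/ k.
      by rewrite leq_divRL // mulnC setTD cardsCs setCK deg.
    apply: leq_trans (leq_mul (leqnn k) (card_setD_cnbhd (fun z _ => kd z))) _.
    by rewrite cZ mulnCA leq_mul2l mulnC leq_divM orbT.
  rewrite setTD cardsCs setCK => h1.
  have cV : #|cnbhd e Z| <= #|V| := max_card _.
  have h2 : j.+1 * #|V| <= k * #|V| by rewrite leq_mul2r jk orbT.
  have h3 : j * (k * m) <= k * (k * m) by rewrite leq_mul2r (ltnW jk) orbT.
  move: h1 h2 h3 hm cV; rewrite mulnBr mulnDr mulSn.
  move: #|cnbhd e Z| #|V| => c n; rewrite expnS expn1; nia.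
rewrite expnS expnS; have := IH (ltnW jk) => h2.
apply: leq_trans (leq_mul (leqnn _) h2) _.
rewrite mulnCA [_ * (2 * k ^ 2) ^ j]mulnC -mulnA leq_mul2l; apply/orP; right.
apply: leq_trans h _; nia.
Qed.

End Colouring.

Section Partition.

Variables (V : finType) (e : rel V) (a k : nat).
Hypotheses (e_sym : symmetric e) (e_irr : irreflexive e).
Hypotheses (Ffree : join_free e a k) (a_gt0 : 0 < a) (k_gt0 : 0 < k).

(* B is the set of vertices missing more than s vertices of a part T j other than
   the one of their colour. *)
Lemma typical_classes (T : 'I_k -> {set V}) s u w :
  complete_family e T -> (forall i, #|T i| = a.+1 * s + a) ->
  (forall v, k * (#|V| - #|nbhd e v|) <= #|V| + k * u) ->
  k * (a.+1 * s + a) * u <= #|V| -> a * #|V| <= s.+1 * w ->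
  exists (g : V -> 'I_k) (B : {set V}), #|B| <= w /\
    forall i v, v \in [set x | g x == i] :\: B ->
      #|([set x | g x == i] :\: B) :&: nbhd e v| < a.
Proof.
set t := _ + a => Tc Tt deg tu sw.
(* The traces of the parts on the neighbourhood of v still form a complete family, so one of them is
   small; its index is the colour of v. *)
have ex v : exists i, #|T i :&: nbhd e v| < a.
  apply: (join_free_large Ffree (v := v)) => [i j ij x y|i]; last exact: subsetIr.
  by rewrite !inE => /andP[xT _] /andP[yT _]; apply: Tc xT yT.
pose g v := xchoose (ex v).
have gP v : #|T (g v) :&: nbhd e v| < a by apply: (xchooseP (ex v)).
pose B := [set v | ~~ [forall j, (j != g v) ==> (#|T j :\: nbhd e v| <= s)]].
exists g, B; split; last first.
  move=> i v vX; apply: (inner_degree_lt e_sym e_irr Ffree (i := i) vX) => A AX Aa.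
  exists (fun j => T j :&: cnbhd e A) => j ji; split; first exact: subsetIr.
    (* The a+1 vertices of A lie outside B, so together they miss at most (a+1)s vertices of T j.
       The size (a+1)s + a of the parts leaves a common neighbours. *)
    have hs : {in A, forall z, #|T j :\: nbhd e z| <= s}.
      move=> z /(subsetP AX); rewrite !inE negbK => /andP[/forallP/(_ j)].
      by move=> /implyP h /eqP gz; apply: h; rewrite gz.
    have := card_setD_cnbhd hs; have := cardsID (cnbhd e A) (T j).
    rewrite Tt Aa /t; lia.
  move=> j' j'i jj' x y; rewrite !inE => /andP[xT _] /andP[yT _].
  exact: Tc xT yT.
(* Non-adjacent pairs between V and the parts, counted from the parts: each of the k t vertices
   there misses at most n/k + u vertices. *)
have count : \sum_(v : V) \sum_i #|T i :\: nbhd e v| <= t * (#|V| + k * u).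
  rewrite -(leq_pmul2l k_gt0).
  have -> : \sum_(v : V) \sum_i #|T i :\: nbhd e v|
      = \sum_i \sum_(x in T i) (#|V| - #|nbhd e x|).
    rewrite exchange_big; apply: eq_bigr => i _ /=.
    transitivity (\sum_(v : V) \sum_(x in T i) (~~ e v x : nat)).
      apply: eq_bigr => v _; rewrite -sum1_card big_mkcond [RHS]big_mkcond.
      apply: eq_bigr => x _ /=; rewrite !inE andbC.
      by case: (x \in T i); case: (e v x).
    rewrite exchange_big; apply: eq_bigr => x _ /=.
    rewrite -(setCK (nbhd e x)) -cardsCs -sum1_card [RHS]big_mkcond.
    by apply: eq_bigr => v _ /=; rewrite !inE e_sym; case: (e x v).
  rewrite big_distrr /=.
  apply: (@leq_trans (\sum_(i < k) t * (#|V| + k * u))); last by rewrite sum_nat_const card_ord.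
  apply: leq_sum => i _; rewrite big_distrr -(Tt i) -sum_nat_const /=.
  by apply: leq_sum => x _; apply: deg.
(* The same pairs counted from V: every vertex misses at least t - (a-1) vertices of its own part,
   and those in B miss s+1 more elsewhere. Comparison gives |B|(s+1) <= (a-1)n + ktu <= an. *)
have lower : #|V| * (t - a.-1) + #|B| * s.+1 <= \sum_(v : V) \sum_i #|T i :\: nbhd e v|.
  have -> : #|V| * (t - a.-1) + #|B| * s.+1
      = \sum_(v : V) (t - a.-1 + (v \in B) * s.+1).
    rewrite big_split sum_nat_const -big_distrl /=; congr (_ + _ * _).
    by rewrite -sum1_card big_mkcond; apply: eq_bigr => v _ /=; case: (v \in B).
  apply: leq_sum => v _; rewrite (bigD1 (g v)) //=; apply: leq_add.
    have := cardsID (nbhd e v) (T (g v)); have := gP v; rewrite Tt; lia.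
  have [|] := boolP (v \in B); rewrite ?mul0n // inE negb_forall => /existsP[j].
  rewrite negb_imply -ltnNge mul1n => /andP[jg hj].
  by rewrite (bigD1 j) //= (leq_trans hj) ?leq_addr.
rewrite -(leq_pmul2l (ltn0Sn s)); apply: leq_trans sw.
have ta : a <= t by rewrite leq_addl.
have := leq_trans lower count; rewrite mulnBr mulnDr.
have : #|V| * a.-1 + #|V| = a * #|V| by rewrite -mulnSr prednK // mulnC.
have : #|V| * a.-1 <= #|V| * t by rewrite leq_mul2l (leq_trans (leq_pred _) ta) orbT.
have : t * (k * u) = k * t * u by lia.
rewrite (mulnC t #|V|) (mulnC _ s.+1).
move: (#|V| * t) (#|V| * a.-1) (s.+1 * _) (t * _) => *; lia.
Qed.

(** Without B the classes have about n/k vertices and are almost completely joined. Every vertex,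
    including those of B, then has few neighbours in some class, since otherwise K_k(a) could be
    chosen greedily in its neighbourhood. Recolouring by that class gives f, and a second greedy
    choice lowers the inner degrees below a. *)
Lemma colouring_of_typical_classes (g : V -> 'I_k) (B : {set V}) u w :
  #|B| <= w -> u <= w -> a <= w -> 29 * k ^ 3 * a ^ 2 * w <= #|V| ->
  (forall v, k * (#|V| - #|nbhd e v|) <= #|V| + k * u) ->
  (forall i v, v \in [set x | g x == i] :\: B ->
      #|([set x | g x == i] :\: B) :&: nbhd e v| < a) ->
  exists f : V -> 'I_k, forall v, #|[set x | f x == f v] :&: nbhd e v| < a.
Proof.
move=> Bw uw aw wV deg inner.
pose W i := [set x | g x == i] :\: B.
pose n := #|V|.
have nd v : k * #|~: nbhd e v| <= n + k * u by rewrite cardsCs setCK deg.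
(* Any vertex of W i misses all but fewer than a vertices of W i, and misses at most n/k + u in
   total. *)
have W_upper i : k * #|W i| <= n + 2 * k * w.
  have [->|/set0Pn[v vW]] := eqVneq (W i) set0; first by rewrite cards0 muln0.
  have := inner i v vW; rewrite -/(W i).
  have := cardsID (nbhd e v) (W i).
  have : #|W i :\: nbhd e v| <= #|~: nbhd e v|.
    by apply: subset_leq_card; rewrite setDE subsetIr.
  have := nd v; move: #|W i| #|_ :&: _| #|_ :\: _| #|~: _| => *; nia.
have W_total : n - w <= \sum_i #|W i|.
  apply: (@leq_trans #|~: B|); first by rewrite [#|~: B|]cardsCs setCK leq_sub2l.
  rewrite -sum1_card (partition_big g xpredT) //=; apply: leq_sum => i _.
  by rewrite -sum1_card; apply/eq_leq/eq_bigl => v; rewrite !inE.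
have W_lower i : n <= k * #|W i| + 3 * (k ^ 2 * w).
  have : k * \sum_i #|W i| <= k * #|W i| + k.-1 * (n + 2 * k * w).
    rewrite (bigD1 i) //= mulnDr leq_add2l big_distrr /=.
    apply: (@leq_trans (\sum_(j | j != i) (n + 2 * k * w))); first exact: leq_sum.
    by rewrite sum_nat_cond_const leq_mul2r; apply/orP; right; rewrite cardsE cardC1 card_ord.
  have := leq_mul (leqnn k) W_total; rewrite mulnBr.
  move: #|W i| (\sum_i _) => x y.
  have -> : k * n = n + k.-1 * n by rewrite -{1}(prednK k_gt0) mulSn.
  have : k.-1 * (2 * k * w) + 3 * (k * w) <= 3 * (k ^ 2 * w).
    rewrite expnS expn1; move: k_gt0; case: (k) => // k' _ /=; nia.
  rewrite mulnDr; move: (k.-1 * n) (k.-1 * _) (k * w) (k * x) (k * y) => *; lia.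
(* The vertices of W i and W j that x misses are disjoint sets of non-neighbours. If x has few
   neighbours in W i, almost all its non-neighbours are there and it misses little of W j. *)
have W_disj i j x : j != i ->
    k * #|W j :\: nbhd e x| + k * #|W i| <= n + k * u + k * #|W i :&: nbhd e x|.
  move=> ji; rewrite -(cardsID (nbhd e x) (W i)) mulnDr [_ + k * #|_ :\: _|]addnC addnA leq_add2r.
  apply: leq_trans (nd x); rewrite -mulnDr leq_mul2l -cardsUI.
  rewrite [_ :&: (W i :\: _)](_ : _ = set0) ?cards0 ?addn0; last first.
    apply/setP => z; rewrite !inE; apply/negP => /andP[/and3P[_ _ /eqP h1] /and3P[_ _ /eqP h2]].
    by rewrite -h1 h2 eqxx in ji.
  by rewrite subset_leq_card ?orbT // !setDE -setIUl subsetIr.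
have [w1 w2 w3 w4] : [/\ k * w <= k ^ 2 * w, k ^ 2 * w <= k ^ 3 * a * w,
    k ^ 3 * a * w <= k ^ 3 * a ^ 2 * w & k * a <= k * w].
  split; last by rewrite leq_mul2l aw orbT.
  - by rewrite leq_mul2r expnS leq_pmulr ?expn_gt0 ?k_gt0 ?orbT.
  - by rewrite leq_mul2r [k ^ 3]expnSr -mulnA leq_pmulr ?muln_gt0 ?k_gt0 ?orbT.
  - by rewrite leq_mul2r leq_mul2l [a ^ 2]expnS leq_pmulr ?expn_gt0 ?a_gt0 ?orbT.
(* 5 = 3 + 1 + 1: the error in [W_lower], the bound u <= w, and the fewer than a neighbours inside W
   i. *)
pose m := 5 * k * w.
have W_miss i j : j != i -> {in W i, forall x, #|W j :\: nbhd e x| <= m}.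
  move=> ji x xW; rewrite -(leq_pmul2l k_gt0).
  have := W_disj i j x ji; have := W_lower i; have := leq_mul (leqnn k) (ltnW (inner i x xW)).
  have : k * u <= k * w by rewrite leq_mul2l uw orbT.
  rewrite /m -/(W i); move: w1 w4; rewrite (_ : k * (5 * k * w) = 5 * (k ^ 2 * w)); last by lia.
  move: (k ^ 2 * w) (k * w) (k * a) (k * u) (k * #|_|) (k * #|_|) (k * #|_|) => *; lia.
pose L := a + k * a * m.
have exf v : exists i, #|W i :&: nbhd e v| < L.
  apply/existsP; apply: contraT; rewrite negb_exists => /forallP h.
  have [|||R [RS Rc]] := @greedy_complete_family V e e_sym k
     (fun j => W j :&: nbhd e v) a m (enum 'I_k).
  - exact: enum_uniq.
  - by move=> i _; rewrite size_enum_ord leqNgt h.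
  - move=> i j _ _ ij x; rewrite inE => /andP[xW _].
    apply: leq_trans (W_miss i j _ x xW); last by rewrite eq_sym.
    by apply/subset_leq_card/setSD/subsetIl.
  case: (Ffree (v := v) (T := R)) => [i j ij|i|i].
  - by apply: Rc; rewrite ?mem_enum.
  - by apply: subset_trans (RS i _).1 (subsetIr _ _); rewrite mem_enum.
  - by apply: (RS i _).2; rewrite mem_enum.
pose f v := xchoose (exf v).
have fP v : #|W (f v) :&: nbhd e v| < L := xchooseP (exf v).
(* 10 = 5 + 1 + 3 + 1: the two terms of L, the error in [W_lower], and u <= w. *)
pose m3 := 10 * k ^ 2 * a * w.
have f_miss v j : j != f v -> #|W j :\: nbhd e v| <= m3.
  move=> jf; rewrite -(leq_pmul2l k_gt0).
  have := W_disj (f v) j v jf; have := W_lower (f v).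
  have := leq_mul (leqnn k) (ltnW (fP v)).
  have : k * u <= k * w by rewrite leq_mul2l uw orbT.
  rewrite /m3 /L /m; move: w1 w2 w4.
  rewrite (_ : k * (10 * k ^ 2 * a * w) = 10 * (k ^ 3 * a * w)); last by lia.
  rewrite (_ : k * (a + k * a * (5 * k * w)) = k * a + 5 * (k ^ 3 * a * w)); last by lia.
  move: (k ^ 3 * a * w) (k ^ 2 * w) (k * w) (k * a) (k * u) (k * #|_|) (k * #|_|) (k * #|_|) => *; lia.
exists f => v.
have vX : v \in [set x | f x == f v] by rewrite inE.
apply: (inner_degree_lt e_sym e_irr Ffree (i := f v) vX) => A AX Aa.
have hm3 j : j != f v -> {in A, forall z, #|W j :\: nbhd e z| <= m3}.
  by move=> jf z /(subsetP AX); rewrite inE => /eqP fz; apply: f_miss; rewrite fz.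
have [|||R [RS Rc]] := @greedy_complete_family V e e_sym k
   (fun j => W j :&: cnbhd e A) a m [seq j <- enum 'I_k | j != f v].
- by rewrite filter_uniq ?enum_uniq.
- move=> j; rewrite mem_filter => /andP[jf _].
  apply: (@leq_trans L).
    rewrite leq_add2l !leq_mul2r; apply/orP; right; apply/orP; right.
    by rewrite size_filter (leq_trans (count_size _ _)) ?size_enum_ord.
  (* 29 = 10 + 10 + 5 + 1 + 3: the a+1 vertices of A missing m3 each, the two terms of L, and the
     error in [W_lower]. *)
  rewrite -(leq_pmul2l k_gt0).
  have := cardsID (cnbhd e A) (W j).
  have := leq_mul (leqnn k) (card_setD_cnbhd (hm3 j jf)); have := W_lower j.
  move: wV w1 w2 w3 w4; rewrite Aa /m3 /L /m -!/n.
  rewrite (_ : k * (a.+1 * (10 * k ^ 2 * a * w)) = 10 * (k ^ 3 * a ^ 2 * w) + 10 * (k ^ 3 * a * w)); last by lia.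
  rewrite (_ : k * (a + k * a * (5 * k * w)) = k * a + 5 * (k ^ 3 * a * w)); last by lia.
  rewrite (_ : 29 * k ^ 3 * a ^ 2 * w = 29 * (k ^ 3 * a ^ 2 * w)); last by lia.
  move=> wV w1 w2 w3 w4 h1 h2 h3; have := congr1 (muln k) h3; rewrite mulnDr.
  move: wV w1 w2 w3 w4 h1 h2.
  move: (k ^ 3 * a ^ 2 * w) (k ^ 3 * a * w) (k ^ 2 * w) (k * w) (k * a) (k * #|_|) (k * #|_|) (k * #|_|) => *; lia.
- move=> i j; rewrite !mem_filter => /andP[fi _] /andP[fj _] ij x; rewrite inE => /andP[xW _].
  apply: leq_trans (W_miss i j _ x xW); last by rewrite eq_sym.
  by apply/subset_leq_card/setSD/subsetIl.
exists R => j jf; have js : j \in [seq j <- enum 'I_k | j != f v] by rewrite mem_filter jf mem_enum.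
have [RW Ra] := RS j js; split; last 2 first.
- by rewrite Ra.
- by move=> j' j'f jj'; apply: Rc; rewrite // mem_filter j'f mem_enum.
by apply: subset_trans RW _; apply: subsetIr.
Qed.

End Partition.

Lemma min_degree_colouring a k : 0 < a -> 0 < k ->
  exists D n0, 0 < D /\ forall (V : finType) (e : rel V),
    symmetric e -> irreflexive e -> n0 <= #|V| -> join_free e a k ->
    (forall v, k * (#|V| - #|nbhd e v|) <= #|V| + k * (#|V| %/ D)) ->
  exists f : V -> 'I_k, forall v, #|[set x | f x == f v] :&: nbhd e v| < a.
Proof.
(* D' makes w = n/D' admissible for the recolouring. The choice s+1 = 2aD' gives an <= (s+1)w, since
   n < (w+1)D' <= 2wD'. The final denominator makes u small enough for 2k^2 u <= n, ktu <= n and u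
   <= w. *)
move=> a0 k0; pose D' := 29 * k ^ 3 * a ^ 2; pose s := (2 * a * D').-1.
have D'0 : 0 < D' by rewrite /D' !muln_gt0 ?expn_gt0 a0 k0.
have s1 : s.+1 = 2 * a * D' by rewrite prednK // muln_gt0 D'0 andbT muln_gt0 a0.
pose t := a.+1 * s + a; have t0 : 0 < t by rewrite addn_gt0 a0 orbT.
have C0 : 0 < (2 * k ^ 2) ^ k by rewrite expn_gt0 muln_gt0 ?expn_gt0 k0.
have [n1 hn1] := dense_cliques_complete_family t k C0.
exists (2 * k ^ 2 * t * D'), (maxn n1 (D' * a)); split.
  by rewrite 3!muln_gt0 expn_gt0 k0 t0 D'0.
move=> V e e_sym e_irr; rewrite geq_max => /andP[n1V aV] Ffree deg.
move: deg; set n := #|V|; set u := n %/ _ => deg; pose w := n %/ D'.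
have uD : u * (2 * k ^ 2 * t * D') <= n by apply: leq_divM.
have k1 : k <= k ^ 2 by rewrite leq_pmulr.
have uk : 2 * k ^ 2 * u <= n.
  apply: leq_trans uD; rewrite mulnC leq_mul2l -mulnA leq_pmulr ?orbT //.
  by rewrite muln_gt0 t0.
have ut : k * t * u <= n.
  apply: leq_trans uD; rewrite mulnC leq_mul2l; apply/orP; right.
  apply: (@leq_trans (2 * k ^ 2 * t)); last by rewrite leq_pmulr.
  by rewrite leq_mul2r (leq_trans k1) ?leq_pmull ?orbT.
have uw : u <= w.
  rewrite leq_divRL //; apply: leq_trans uD; rewrite leq_mul2l; apply/orP; right.
  by rewrite leq_pmull // 2!muln_gt0 expn_gt0 k0 t0.
have aw : a <= w by rewrite leq_divRL // mulnC.
have wD : w * D' <= n by apply: leq_divM.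
have [T [Tc _ Tt]] := hn1 V e [set: V] n e_sym e_irr n1V (max_card _)
  (clique_density e_sym e_irr k0 deg uk).
have sw : a * n <= s.+1 * w.
  have := ltn_ceil n D'0; rewrite -/w mulSn s1 => h.
  have : D' <= w * D' by rewrite leq_pmull // (leq_trans a0).
  move=> h2; rewrite (_ : 2 * a * D' * w = a * (2 * (w * D'))); last by lia.
  by rewrite leq_mul2l mul2n -addnn; apply/orP; right; apply: ltnW (leq_trans h _); rewrite leq_add2r.
have [g [B [Bw inner]]] := typical_classes e_sym e_irr Ffree a0 k0 Tc Tt deg ut sw.
apply: (colouring_of_typical_classes e_sym e_irr Ffree a0 k0 Bw uw aw _ deg inner).
by rewrite mulnC.
Qed.

(** * Labelled copies *)

Section Embeddings.

Variables (V : finType) (e : rel V).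
Hypotheses (e_sym : symmetric e) (e_irr : irreflexive e).
Implicit Types (S K Z A : {set V}) (v w x y : V).

(** Labelled copies of K_k(b), part by part. Injectivity is asked within each part; between parts it
    follows from adjacency when [e] is irreflexive. *)
Definition embs k b : {set {ffun 'I_k -> {ffun 'I_b -> V}}} :=
  [set X : {ffun 'I_k -> {ffun 'I_b -> V}} | [forall i, injectiveb (X i)] &&
     [forall i, forall i', (i != i') ==> [forall j, forall j', e (X i j) (X i' j')]]].

Definition embs_at k b v := [set X in embs k b | [exists i, exists j, X i j == v]].

Lemma embsP k b (X : {ffun 'I_k -> {ffun 'I_b -> V}}) :
  reflect ((forall i, injective (X i)) /\
           forall i i', i != i' -> forall j j', e (X i j) (X i' j'))
          (X \in embs k b).
Proof.
rewrite inE; apply: (iffP andP) => -[h1 h2]; split.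
- by move=> i; apply/injectiveP; apply: (forallP h1).
- move=> i i' ii' j j'; move: h2 => /forallP/(_ i)/forallP/(_ i')/implyP/(_ ii').
  by move=> /forallP/(_ j)/forallP.
- by apply/forallP => i; apply/injectiveP.
- apply/forallP => i; apply/forallP => i'; apply/implyP => ii'.
  by apply/forallP => j; apply/forallP => j'; apply: h2.
Qed.

Lemma sum_cliques_at k v (h : {set V} -> nat) :
  \sum_(K in cliques e [set: V] k.+1 | v \in K) h K =
  \sum_(Z in cliques e (nbhd e v) k) h (v |: Z).
Proof.
rewrite (reindex_onto (fun Z => v |: Z) (fun K => K :\ v)) /=; last first.
  by move=> K /andP[_ vK]; rewrite setD1K.
apply: eq_bigl => Z; rewrite setU11 andbT.
have [vZ|vZ] := boolP (v \in Z).
  have -> : (v |: Z) :\ v == Z = false.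
    by apply/eqP => /setP/(_ v); rewrite !inE eqxx vZ.
  rewrite andbF inE; symmetry; apply/negP => /and3P[/subsetP/(_ v vZ)].
  by rewrite inE e_irr.
rewrite setU1K // eqxx andbT [LHS]inE [RHS]inE subsetT /= cardsU1 vZ add1n eqSS clique_setU1 //.
have -> : (v \in cnbhd e Z) = (Z \subset nbhd e v).
  apply/cnbhdP/subsetP => vN z zZ; last by rewrite e_sym; have := vN z zZ; rewrite inE.
  by rewrite inE e_sym vN.
by case: (Z \subset _); case: (_ == k); case: (clique e Z).
Qed.

(* Bounds the number of labelled copies of K_k(b+1) having the k-clique K as a
   transversal: the other b vertices of the part of y are adjacent to K - y. *)
Definition extensions b K := \prod_(y in K) #|cnbhd e (K :\ y)| ^ b.

Lemma card_injections_onto k K : #|K| = k ->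
  #|[set x : {ffun 'I_k -> V} | injectiveb x && ([set x i | i : 'I_k] == K)]| <= k`!.
Proof.
move=> Kk; have := card_inj_ffuns_on 'I_k (mem K); rewrite card_ord.
have -> : #|mem K| = k by rewrite -Kk; apply: eq_card.
rewrite ffactnn => <-; apply: subset_leq_card; apply/subsetP => x.
rewrite !inE => /andP[-> /eqP <-]; rewrite andbT; apply/ffun_onP => i.
by apply/imsetP; exists i.
Qed.

(** Once column j is fixed to x, every other entry of row i is a common neighbour of K - x i. The
    Boolean factors make the bound vanish unless x lists a clique injectively. *)
Lemma card_embs_column k b (j : 'I_b.+1) (x : {ffun 'I_k -> V}) :
  #|[set X in embs k b.+1 | [ffun i => X i j] == x]|
    <= injectiveb x * (clique e [set x i | i : 'I_k] * extensions b [set x i | i : 'I_k]).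
Proof.
set K := [set x i | i : 'I_k].
have [->|/set0Pn[X]] := eqVneq [set X in embs k b.+1 | [ffun i => X i j] == x] set0.
  by rewrite cards0.
rewrite inE => /andP[/embsP[_ Xe] /eqP Xx].
have xe i i' : i != i' -> e (x i) (x i') by move=> ii'; rewrite -Xx !ffunE Xe.
have xinj : injective x.
  by move=> i i' xx; apply/eqP; apply: contraT => /xe; rewrite xx e_irr.
have -> : injectiveb x by apply/injectiveP.
have -> : clique e K.
  apply/cliqueP => _ _ /imsetP[i _ ->] /imsetP[i' _ ->] ii'.
  by apply: xe; apply: contraNneq ii' => ->.
rewrite !mul1n /extensions big_imset /=; last by move=> ? ? _ _; apply: xinj.
pose N i := cnbhd e (K :\ x i).
pose row i : {pred {ffun 'I_b.+1 -> V}} :=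
  family (fun j' => if j' == j then mem [set x i] else mem (N i)).
apply: (@leq_trans #|(family row : {pred {ffun 'I_k -> {ffun 'I_b.+1 -> V}}})|).
  apply: subset_leq_card; apply/subsetP => Y; rewrite inE => /andP[/embsP[_ Ye] /eqP Yx].
  apply/familyP => i; apply/familyP => j'; case: eqVneq => [->|_].
    by rewrite inE -Yx ffunE.
  apply/cnbhdP => z; rewrite !inE => /andP[zi /imsetP[i' _ zE]].
  rewrite zE -Yx ffunE; apply: Ye; apply: contraNneq zi => <-.
  by rewrite zE.
rewrite card_family foldrE big_map big_enum /=.
apply: leq_prod => i _; rewrite card_family foldrE big_map big_enum /=.
rewrite (bigD1 j) //= eqxx.
have -> : #|mem [set x i]| = 1 by rewrite -(cards1 (x i)); apply: eq_card.
rewrite mul1n (eq_bigr (fun=> #|N i|)) => [|j' /negbTE->]; last exact: eq_card.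
by rewrite prod_nat_const cardC1 card_ord.
Qed.

(** The vertex v lies in one of the b+1 columns, and that column is one of at most (k+1)! orderings
    of a (k+1)-clique through v. *)
Lemma card_embs_at k b v :
  #|embs_at k.+1 b.+1 v| <=
    b.+1 * (k.+1`! *
      \sum_(K in cliques e [set: V] k.+1 | v \in K) extensions b K).
Proof.
pose col (j : 'I_b.+1) (X : {ffun 'I_k.+1 -> {ffun 'I_b.+1 -> V}}) : {ffun 'I_k.+1 -> V} := [ffun i => X i j].
pose im (x : {ffun 'I_k.+1 -> V}) := [set x i | i : 'I_k.+1].
pose P j := [set X in embs k.+1 b.+1 | v \in im (col j X)].
apply: (@leq_trans #|\bigcup_(j : 'I_b.+1) P j|).
  apply: subset_leq_card; apply/subsetP => X; rewrite inE => /andP[Xe].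
  move=> /existsP[i /existsP[j /eqP ij]]; apply/bigcupP; exists j => //.
  by rewrite inE Xe; apply/imsetP; exists i => //; rewrite ffunE.
rewrite -big_enum; apply: leq_trans (card_bigcup_seq (m := k.+1`! * _) _) _; last first.
  by rewrite size_enum_ord.
move=> j _ /=.
pose Q : pred {ffun 'I_k.+1 -> V} := fun f => v \in im f.
rewrite -sum1_card (partition_big (col j) Q) => [|X]; last first.
  by rewrite inE => /andP[].
apply: (@leq_trans (\sum_(x : {ffun 'I_k.+1 -> V} | v \in im x)
   injectiveb x * (clique e (im x) * extensions b (im x)))).
  apply: leq_sum => x vx; apply: leq_trans (card_embs_column j x).
  rewrite -sum1_card; apply: eq_leq; apply: eq_bigl => X; rewrite !inE.
  by case: eqP => [Xx|]; rewrite ?andbF // Xx (vx : v \in im x) !andbT.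
rewrite (bigID (fun x : {ffun 'I_k.+1 -> V} => injectiveb x && clique e (im x))) /=.
rewrite [X in _ + X]big1 ?addn0; last first.
  by move=> x /andP[_]; case: (injectiveb x) => //=; case: (clique _ _).
rewrite (partition_big im (fun K => (K \in cliques e [set: V] k.+1) && (v \in K))) /=; last first.
  move=> x /and3P[vx /injectiveP xi xc]; rewrite vx andbT inE subsetT xc andbT /=.
  by rewrite card_imset ?card_ord.
rewrite big_distrr; apply: leq_sum => K /andP[KC _].
have Kk : #|K| = k.+1 by move: KC; rewrite inE => /and3P[_ /eqP].
rewrite (eq_bigr (fun=> extensions b K)) => [|x /andP[/and3P[_ -> ->] /eqP->]]; last first.
  by rewrite !mul1n.
rewrite sum_nat_cond_const leq_mul2r; apply/orP; right.
apply: leq_trans (card_injections_onto Kk); apply: subset_leq_card; apply/subsetP => x.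
by rewrite !inE => /andP[/and3P[_ -> _] ->].
Qed.

End Embeddings.

(** * From many copies to minimum degree *)

Lemma leq_mul_succ2 j : j * j.+2 <= j.+1 ^ 2.
Proof. by rewrite !expnS expn0; lia. Qed.

Lemma leq_succ2_mul m D : 0 < D -> m.+2 <= m.+1 * (2 * D).
Proof. nia. Qed.

Lemma leq_succ_sub q b : q.+1 <= q - b.+1 + b.+3.
Proof. lia. Qed.

(** A division-free form of d <= (m/(m+1) - 1/(2D)) n; for n >= 2D the rounded quotient q is still
    at least n/(2D). *)
Lemma degree_deficit D m d n q : n + m.+1 * q < m.+1 * (n - d) -> n < q.+1 * D ->
  2 * D <= n -> 2 * D * m.+1 * d + m.+1 * n <= 2 * D * m * n.
Proof.
rewrite mulnBr => low hq Dn.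
have h : m.+1 * d + m.+1 * q <= m * n.
  by move: low; rewrite [m.+1 * n]mulSn; lia.
have h1 : n <= 2 * D * q by lia.
have := leq_mul (leqnn m.+1) h1; have := leq_mul (leqnn (2 * D)) h; lia.
Qed.

Section Estimates.

Import Order.TTheory GRing.Theory Num.Theory.
Local Open Scope ring_scope.

(** Induction along Horner's scheme. This replaces continuity at 0, so that the estimates can be
    carried out over the rationals. *)
Lemma poly_lower_bound (R : realFieldType) (p : {poly R}) :
  exists2 B, 0 <= B & forall x, 0 <= x <= 1 -> p.[0] - B * x <= p.[x].
Proof.
elim/poly_ind: p => [|p c [B B0 hB]].
  by exists 0 => // x _; rewrite !horner0; lra.
exists (`|p.[0]| + B) => [|x /andP[x0 x1]]; first by rewrite addr_ge0.
rewrite !hornerMXaddC mulr0 add0r.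
have := hB x; rewrite x0 x1 => /(_ isT) h.
have h1 : - `|p.[0]| <= p.[0] by rewrite lerNl -normrN ler_norm.
have h2 : B * x <= B by rewrite ler_piMr.
have : (- `|p.[0]| - B) * x <= p.[x] * x by rewrite ler_wpM2r //; lra.
lra.
Qed.

Lemma poly_pos_near0 (R : realFieldType) (p : {poly R}) t :
  0 < p.[0] -> 0 < t -> exists2 x, 0 < x <= t & 0 < p.[x].
Proof.
move=> p0 t0; have [B B0 hB] := poly_lower_bound p.
have B1 : 0 < B + 1 by lra.
pose s := Num.min (Num.min t 1) (p.[0] / (B + 1)).
have s0 : 0 < s by rewrite !lt_min t0 ltr01 divr_gt0.
have [s1 s2 s3] : [/\ s <= t, s <= 1 & s <= p.[0] / (B + 1)].
  by rewrite /s !ge_min !lexx !orbT.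
exists s; first by rewrite s0.
apply: lt_le_trans (hB s _); last by rewrite (ltW s0).
move: s3; rewrite ler_pdivlMr //; lra.
Qed.

(* Moon-Moser gives r_j <= (mu (m-j) / (m (j+1)) + tau) n for the ratios
   r_j = c_(j+1) / c_j of clique numbers, by descending induction from
   r_m <= tau n; the case c_m <= tau n^m is the summand tau. *)
Lemma card_cliques_density (V : finType) (e : rel V) (S : {set V}) m n (mu tau : rat) :
  symmetric e -> irreflexive e -> (0 < m)%N -> (0 < n)%N -> 0 <= mu -> 0 < tau ->
  #|S|%:R <= mu * n%:R -> #|cliques e S m.+1|%:R <= tau ^+ 2 * n%:R ^+ m.+1 ->
  #|cliques e S m|%:R <=
    (tau + \prod_(j < m) (mu * (m - j)%:R / (m%:R * j.+1%:R) + tau)) * n%:R ^+ m.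
Proof.
move=> e_sym e_irr m0 n0 mu0 tau0 Sn few.
pose c j : rat := #|cliques e S j|%:R.
pose r j : rat := mu * (m - j)%:R / (m%:R * j.+1%:R) + tau.
have n0' : 0 < n%:R :> rat by rewrite ltr0n.
have m0' : 0 < m%:R :> rat by rewrite ltr0n.
have r0 j : 0 <= r j by rewrite addr_ge0 ?divr_ge0 ?mulr_ge0 // ltW.
have prod0 : 0 <= \prod_(j < m) r j by apply: prodr_ge0.
rewrite mulrDl; have [small|large] := lerP (c m) (tau * n%:R ^+ m).
  apply: le_trans small _; rewrite lerDl mulr_ge0 // exprn_ge0 // ltW //.
(* A vanishing c_j would force c_m = 0 through [sum_codegree], while c_m is large here. Positivity
   permits cancelling the clique numbers below. *)
have cpos j : (j <= m)%N -> 0 < c j.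
  move=> jm; rewrite ltr0n lt0n; apply: contraTneq large => cj0; rewrite -leNgt.
  suff -> : c m = 0 by rewrite mulr_ge0 ?exprn_ge0 // ltW.
  have : forall i, #|cliques e S (j + i)%N| = 0%N.
    elim=> [|i IH]; first by rewrite addn0.
    have := sum_codegree e_sym e_irr S (j + i)%N.
    rewrite (cards0_eq IH) big_set0 => /esym/eqP; rewrite muln_eq0 /= addnS => /eqP.
    by [].
  by move=> /(_ (m - j)%N); rewrite subnKC // /c => ->.
have step i : (i <= m)%N -> c (m - i).+1 <= c (m - i)%N * (r (m - i)%N * n%:R).
  elim: i => [_|i IH im].
    rewrite subn0 /r subnn mulr0 mul0r add0r.
    apply: le_trans few _.
    have -> : tau ^+ 2 * n%:R ^+ m.+1 = tau * n%:R * (tau * n%:R ^+ m) by rewrite [_ ^+ m.+1]exprS; ring.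
    by rewrite [c m * _]mulrC ler_wpM2l ?ltW // mulr_gt0.
  have := IH (ltnW im); set j := (m - i.+1)%N.
  have -> : (m - i)%N = j.+1 by rewrite /j subnSK.
  have jm : (j < m)%N by rewrite ltn_subrL m0.
  move=> hj; have cj1 := cpos _ jm; have cj := cpos _ (ltnW jm).
  have := Moon_Moser e_sym e_irr S j.
  rewrite -(ler_nat rat) natrX !natrM natrD !natrM -!/(c _) => MM.
  have q0 : 0 < j.+1%:R :> rat by rewrite ltr0n.
  (* Moon-Moser divided by c_(j+1), with c_(j+2) replaced by the bound from the previous step of the
     descent. *)
  have : j.+1%:R ^+ 2 * c j.+1 <= c j * (mu * n%:R + j%:R * (j.+2%:R * (r j.+1 * n%:R))).
    rewrite -(ler_pM2r cj1).
    have -> : j.+1%:R ^+ 2 * c j.+1 * c j.+1 = (j.+1%:R * c j.+1) ^+ 2 by ring.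
    apply: le_trans MM _. rewrite -[X in _ <= X]mulrA ler_wpM2l ?(ltW cj) // [X in _ <= X]mulrDl lerD //.
      by rewrite ler_wpM2r // ltW.
    have -> : j%:R * (j.+2%:R * (r j.+1 * n%:R)) * c j.+1
        = j%:R * (j.+2%:R * (c j.+1 * (r j.+1 * n%:R))) by ring.
    by rewrite !ler_wpM2l.
  move=> h; rewrite -(@ler_pM2l _ (j.+1%:R ^+ 2)) ?exprn_gt0 //.
  apply: le_trans h _; rewrite [X in _ <= X]mulrCA ler_wpM2l ?(ltW cj) //.
  have -> : mu * n%:R + j%:R * (j.+2%:R * (r j.+1 * n%:R))
      = (mu + j%:R * j.+2%:R * r j.+1) * n%:R by ring.
  rewrite [X in _ <= X]mulrA ler_wpM2r ?(ltW n0') //.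
  pose s i : rat := mu * (m - i)%:R / (m%:R * i.+1%:R).
  (* The main term s solves the recursion exactly; the error tau does not grow because j(j+2) <=
     (j+1)^2. *)
  have E : mu + j%:R * j.+2%:R * s j.+1 = j.+1%:R ^+ 2 * s j.
    rewrite /s (natrB _ (ltnW jm)) (natrB _ jm) -!natr1; field.
    by rewrite (gt_eqF m0') !natr1 !pnatr_eq0.
  have le_sq : j%:R * j.+2%:R <= j.+1%:R ^+ 2 :> rat by rewrite -natrM -natrX ler_nat leq_mul_succ2.
  rewrite -!/(s _) [X in _ <= X]mulrDr -E [j%:R * _ * (_ + _)]mulrDr addrA lerD2l.
  by rewrite ler_wpM2r ?(ltW tau0).
have bound i : (i <= m)%N -> c i <= (\prod_(j < i) r j) * n%:R ^+ i.
  elim: i => [_|i IH im].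
    rewrite big_ord0 mul1r expr0 /c lern1.
    exact: (card_cliques e 0 (leqnn _)).
  have := step (m - i)%N (leq_subr _ _); rewrite subKn ?(ltnW im) // => h.
  apply: le_trans h _; rewrite big_ord_recr exprSr /= mulrACA.
  by apply: ler_wpM2r; [rewrite mulr_ge0 // ltW | apply/IH/ltnW].
apply: le_trans (bound m (leqnn _)) _.
by rewrite lerDr mulr_ge0 ?exprn_ge0 ?ltW.
Qed.

(** AM-GM over the codegrees of the sets K - y, whose sum [sum_cnbhd_clique] bounds. *)
Lemma extensions_le (V : finType) (e : rel V) b (K : {set V}) :
  K != set0 ->
  (extensions e b K)%:R <=
    ((#|V|%:R + #|K|.-1%:R * #|cnbhd e K|%:R) / #|K|%:R) ^+ (#|K| * b) :> rat.
Proof.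
move=> K0; pose E y : rat := #|cnbhd e (K :\ y)|%:R.
have -> : (extensions e b K)%:R = (\prod_(y in K) E y) ^+ b.
  by rewrite /extensions natr_prod -prodrXl; apply: eq_bigr => y _; rewrite natrX.
rewrite exprM lerXn2r ?nnegrE ?prodr_ge0 //; last 2 first.
- by rewrite exprn_ge0 // divr_ge0 // addr_ge0 // mulr_ge0.
have AGM : \prod_(y in K) E y <= ((\sum_(y in K) E y) / #|K|%:R) ^+ #|K|.
  by have [] := leif_AGM (A := mem K) (E := E) (fun _ _ => ler0n _ _).
apply: le_trans AGM _; rewrite lerXn2r ?nnegrE //.
- by rewrite divr_ge0 // sumr_ge0.
- by rewrite divr_ge0 // addr_ge0 // mulr_ge0.
rewrite ler_wpM2r ?invr_ge0 // /E -natr_sum -natrM -natrD ler_nat.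
have := sum_cnbhd_clique e setT K; rewrite cardsT setTI.
by under eq_bigr do rewrite setTI.
Qed.

(** If D Z <= tau n, [extensions_le] bounds the term by A. Otherwise the trivial bound is multiplied
    by D Z / (tau n) >= 1; as in Markov's inequality these factors sum to little, since the
    neighbourhood of v has few (m+1)-cliques. *)
Lemma sum_extensions_at_le (V : finType) (e : rel V) b m v (tau : rat) :
  symmetric e -> irreflexive e -> 0 < tau -> (0 < #|V|)%N ->
  #|cliques e (nbhd e v) m.+1|%:R <= tau ^+ 2 * #|V|%:R ^+ m.+1 ->
  (\sum_(K in cliques e [set: V] m.+1 | v \in K) extensions e b K)%:R <=
    #|cliques e (nbhd e v) m|%:R * ((m.+1%:R^-1 + tau) * #|V|%:R) ^+ (m.+1 * b)
    + m.+1%:R * tau * #|V|%:R ^+ m * #|V|%:R ^+ (m.+1 * b).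
Proof.
move=> e_sym e_irr tau0 V0 few; rewrite (sum_cliques_at e_sym e_irr) natr_sum.
set A := (_ * _) ^+ _; set n : rat := #|V|%:R.
have n0 : 0 < n by rewrite ltr0n.
have tn0 : 0 < tau * n by rewrite mulr_gt0.
have k0 : 0 < m.+1%:R :> rat by rewrite ltr0n.
have A0 : 0 <= A by rewrite exprn_ge0 // mulr_ge0 // addr_ge0 ?invr_ge0 // ltW.
pose D (Z : {set V}) : rat := #|nbhd e v :&: cnbhd e Z|%:R.
have term Z : Z \in cliques e (nbhd e v) m ->
    (extensions e b (v |: Z))%:R <= A + D Z / (tau * n) * n ^+ (m.+1 * b).
  rewrite inE => /and3P[Zv /eqP Zm _].
  have vZ : v \notin Z by apply/negP => /(subsetP Zv); rewrite inE e_irr.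
  have cK : #|v |: Z| = m.+1 by rewrite cardsU1 vZ Zm.
  have DE : #|cnbhd e (v |: Z)|%:R = D Z.
    congr _%:R; apply: eq_card => w; rewrite !inE.
    apply/forall_inP/andP => [h|[vw /forall_inP h] z].
      split; first by apply: h; rewrite setU11.
      by apply/forall_inP => z zZ; apply: h; rewrite inE zZ orbT.
    by rewrite !inE => /orP[/eqP->|/h].
  have [good|bad] := lerP (D Z) (tau * n).
    apply: (@le_trans _ _ A); last first.
      by rewrite lerDl mulr_ge0 ?exprn_ge0 ?divr_ge0 // ltW.
    have K0 : v |: Z != set0 by rewrite -card_gt0 cK.
    apply: le_trans (extensions_le e b K0) _.
    rewrite cK DE lerXn2r ?nnegrE //.
    - by rewrite divr_ge0 // addr_ge0 // mulr_ge0.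
    - by rewrite mulr_ge0 // addr_ge0 ?invr_ge0 // ltW.
    rewrite ler_pdivrMr // -/n mulrAC mulrDl mulVf ?gt_eqF // mulrDl mul1r lerD2l /=.
    apply: le_trans (ler_wpM2l (ler0n _ _) good) _.
    by rewrite mulrC (mulrC tau m.+1%:R) -(mulrA m.+1%:R) mulrC ler_wpM2r ?(ltW tn0) // ler_nat.
  apply: (@le_trans _ _ (n ^+ (m.+1 * b))).
    rewrite -natrX ler_nat /extensions -cK mulnC expnM -prod_nat_const.
    by apply: leq_prod => y _; rewrite leq_expn2r ?max_card.
  rewrite -[X in X <= _]add0r lerD // ler_peMl ?exprn_ge0 ?(ltW n0) //.
  by rewrite ler_pdivlMr // mul1r ltW.
apply: le_trans (ler_sum _ term) _.
rewrite big_split /= sumr_const -[A *+ _]mulr_natl lerD2l -mulr_suml -mulr_suml.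
rewrite ler_wpM2r ?exprn_ge0 ?(ltW n0) // -natr_sum (sum_codegree e_sym e_irr) natrM.
rewrite ler_pdivrMr //.
have -> : m.+1%:R * tau * n ^+ m * (tau * n) = m.+1%:R * (tau ^+ 2 * n ^+ m.+1).
  by rewrite [n ^+ m.+1]exprS; ring.
by rewrite ler_wpM2l.
Qed.

(** Reversing the index turns the numerators into the denominators. Hence the main ratios of the
    clique bound multiply to (mu/m)^m. *)
Lemma prod_falling_ratio m : \prod_(j < m) ((m - j)%:R / j.+1%:R) = 1 :> rat.
Proof.
rewrite prodf_div (reindex_inj rev_ord_inj) /=.
rewrite (eq_bigr (fun j : 'I_m => j.+1%:R)) => [|j _]; last by rewrite subKn.
by rewrite divff //; apply/prodf_neq0 => j _; rewrite pnatr_eq0.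
Qed.

(** By contraposition: a smaller degree is at most mu n with mu < (k-1)/k, so there are too few
    (k-1)-cliques in the neighbourhood of v, hence too few copies at v. The assumed number of copies
    is the lower bound for the increment in [turan_embsS]. *)
Lemma min_degree_of_min_copies a b k D :
  (0 < b)%N -> (0 < k)%N -> (0 < D)%N ->
  exists n0, forall (V : finType) (e : rel V),
    symmetric e -> irreflexive e -> (n0 <= #|V|)%N -> join_free e a k ->
    forall v, (k`! * b * (#|V|.-1 %/ k - b) ^ (k * b).-1 <= #|embs_at e k b v|)%N ->
    (k * (#|V| - #|nbhd e v|) <= #|V| + k * (#|V| %/ D))%N.
Proof.
case: b => // b _; case: k => // -[_ _|m' _ D0].
  (* For k = 1 the right-hand side is already at least |V|. *)
  by exists 0%N => V e _ _ _ _ v _; rewrite !mul1n (leq_trans (leq_subr _ _)) // leq_addr.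
set m := m'.+1.
pose K : rat := m.+1%:R; pose mu : rat := m%:R / K - (2 * D%:R)^-1.
have K0 : 0 < K by rewrite ltr0n.
have m0 : 0 < m%:R :> rat by rewrite ltr0n.
have D0' : 0 < D%:R :> rat by rewrite ltr0n.
have mK : m%:R = K - 1 by rewrite /K -natr1 addrK.
have D2 : 0 < 2 * D%:R :> rat by rewrite mulr_gt0.
have mu0 : 0 <= mu.
  rewrite subr_ge0 ler_pdivlMr // mulrC ler_pdivrMr // /K -!natrM ler_nat leq_succ2_mul //.
(* All error parameters are powers of one variable; at 0 the two sides compare
   strictly, and p measures their difference. *)
pose r j : rat := mu * (m - j)%:R / (m%:R * j.+1%:R).
pose p : {poly rat} := (K^-1%:P - 'X) ^+ (m.+1 * b + m)
  - (('X + \prod_(j < m) ((r j)%:P + 'X)) * (K^-1%:P + 'X) ^+ (m.+1 * b) + K *: 'X).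
have pE x : p.[x] = (K^-1 - x) ^+ (m.+1 * b + m)
  - ((x + \prod_(j < m) (r j + x)) * (K^-1 + x) ^+ (m.+1 * b) + K * x).
  rewrite /p !(hornerE, horner_exp, horner_prod).
  by under [in LHS]eq_bigr do rewrite !hornerE.
(* At 0 the claim is (mu/m)^m < K^-m after cancelling the power of 1/K, and mu/m < 1/K because mu <
   m/K = (K-1)/K. *)
have p0 : 0 < p.[0].
  rewrite pE subr0 mulr0 add0r !addr0.
  have -> : \prod_(j < m) (r j + 0) = (mu / m%:R) ^+ m.
    under eq_bigr do rewrite addr0.
    have -> : \prod_(j < m) r j
        = \prod_(j < m) (mu / m%:R) * \prod_(j < m) ((m - j)%:R / j.+1%:R).
      by rewrite -big_split; apply: eq_bigr => j _; rewrite /r invfM /=; ring.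
    by rewrite prod_falling_ratio mulr1 prodr_const card_ord.
  rewrite exprD mulrC subr_gt0 ltr_pM2r ?exprn_gt0 ?invr_gt0 //.
  have muK : mu / m%:R < K^-1.
    by rewrite ltr_pdivrMr // mulrC /mu ltrBlDr ltrDl invr_gt0.
  by rewrite ltrXn2r ?divr_ge0 ?(ltW m0).
have Kinv0 : 0 < K^-1 by rewrite invr_gt0.
have [tau /andP[tau0 tauK] ptau] := poly_pos_near0 p0 Kinv0.
pose C := Num.bound (tau ^- 2).
have tau2 : 0 < tau ^+ 2 by rewrite exprn_gt0.
have tauC : tau ^- 2 < C%:R by apply/archi_boundP; rewrite invr_ge0 ltW.
have C0 : (0 < C)%N by rewrite -(ltr0n rat) (lt_trans _ tauC) ?invr_gt0.
have [n1 hn1] := dense_cliques_complete_family a m.+1 C0.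
exists (maxn n1 (maxn (2 * D) (Num.bound (b.+3%:R / tau)))) => V e e_sym e_irr.
rewrite !geq_max => /and3P[n1V DV bV] Ffree v copies.
have V0 : (0 < #|V|)%N by apply: leq_trans DV; rewrite muln_gt0.
rewrite leqNgt; apply/negP => low.
set n : rat := #|V|%:R.
have n0 : 0 < n by rewrite ltr0n.
(* More cliques would produce K_k(a) inside the neighbourhood of v; C was taken above tau^-2 for
   this. *)
have few : #|cliques e (nbhd e v) m.+1|%:R <= tau ^+ 2 * n ^+ m.+1.
  have [dense|sparse] := leqP (#|V| ^ m.+1) (C * #|cliques e (nbhd e v) m.+1|).
    have [T [Tc TS Ta]] := hn1 V e (nbhd e v) _ e_sym e_irr n1V (max_card _) dense.
    by case: (Ffree v T Tc TS Ta).
  have : tau ^- 2 * #|cliques e (nbhd e v) m.+1|%:R <= n ^+ m.+1.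
    apply: le_trans (ler_wpM2r (ler0n _ _) (ltW tauC)) _.
    by rewrite /n -natrM -natrX ler_nat ltnW.
  by rewrite -(ler_pM2l tau2) mulrA divff ?mul1r // gt_eqF.
have degv : #|nbhd e v|%:R <= mu * n.
  have dV : (#|nbhd e v| <= #|V|)%N := max_card _.
  have hD := ltn_ceil #|V| D0.
  have key : (2 * D * m.+1 * #|nbhd e v| + m.+1 * #|V| <= 2 * D * m * #|V|)%N.
    exact: degree_deficit low hD DV.
  rewrite -subr_ge0.
  have -> : mu * n - #|nbhd e v|%:R =
    (2 * D%:R * m%:R * n - (2 * D%:R * K * #|nbhd e v|%:R + K * n)) / (2 * D%:R * K).
    by rewrite /mu; field; rewrite (gt_eqF K0) (gt_eqF D0').
  rewrite divr_ge0 ?mulr_ge0 ?(ltW K0) // subr_ge0.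
  by rewrite /K /n -!natrM -natrD ler_nat.
have bound_cl := card_cliques_density e_sym e_irr (isT : (0 < m)%N) V0 mu0 tau0 degv few.
have bound_ext := sum_extensions_at_le b e_sym e_irr tau0 V0 few.
have := leq_trans copies (card_embs_at e_irr m b v).
rewrite mulnA [(b.+1 * _)%N]mulnC leq_pmul2l ?muln_gt0 ?fact_gt0 //.
have -> : ((m.+1 * b.+1).-1 = m.+1 * b + m)%N by rewrite mulnS addSn [RHS]addnC.
rewrite -(ler_nat rat) natrX => lower.
(* Rounding and the subtracted part size cost a constant, at most b+3, which tau n absorbs for large
   n. *)
have base : (K^-1 - tau) * n <= (#|V|.-1 %/ m.+1 - b.+1)%:R.
  have hq := ltn_ceil #|V|.-1 (ltn0Sn m); rewrite prednK // in hq.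
  have tn : b.+3%:R <= tau * n.
    rewrite mulrC -ler_pdivrMr //; apply: le_trans (ltW (archi_boundP _)) _.
      by rewrite divr_ge0 // ltW.
    by rewrite ler_nat.
  have nK : K^-1 * n <= (#|V|.-1 %/ m.+1).+1%:R.
    by rewrite mulrC ler_pdivrMr // /n /K -natrM ler_nat.
  have : ((#|V|.-1 %/ m.+1).+1%:R <= (#|V|.-1 %/ m.+1 - b.+1)%:R + b.+3%:R :> rat).
    by rewrite -natrD ler_nat leq_succ_sub.
  by move/(le_trans nK) => h; rewrite mulrBl lerBlDr (le_trans h) ?lerD2l.
have base0 : 0 <= (K^-1 - tau) * n by rewrite mulr_ge0 ?subr_ge0 // ltW.
have lower' : ((K^-1 - tau) * n) ^+ (m.+1 * b + m) <=
    (\sum_(K in cliques e [set: V] m.+1 | v \in K) extensions e b K)%:R.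
  by apply: le_trans lower; rewrite lerXn2r ?nnegrE.
have nE : n ^+ (m.+1 * b + m) = n ^+ m * n ^+ (m.+1 * b) by rewrite exprD mulrC.
have := le_trans lower' bound_ext; apply/negP; rewrite -ltNge -/K -/n.
rewrite !exprMn nE.
have Kt0 : 0 <= (K^-1 + tau) ^+ (m.+1 * b) * n ^+ (m.+1 * b).
  by rewrite mulr_ge0 ?exprn_ge0 ?addr_ge0 ?(ltW Kinv0) ?(ltW tau0) ?(ltW n0).
apply: le_lt_trans (lerD (ler_wpM2r Kt0 bound_cl) (lexx _)) _.
have N0 : 0 < n ^+ m * n ^+ (m.+1 * b) by rewrite mulr_gt0 ?exprn_gt0.
move: ptau; rewrite pE subr_gt0 -(ltr_pM2r N0) => h.
apply: le_lt_trans h; rewrite le_eqVlt; apply/orP; left; apply/eqP.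
rewrite -/n /r; ring.
Qed.

End Estimates.

(** * Copies in a coloured graph *)

Section Rainbow.

Variables (V : finType) (k b : nat) (f : V -> 'I_k).
Hypothesis b_gt0 : 0 < b.

Definition colour_class i := [set x | f x == i].

Definition rainbow_of (s : {perm 'I_k}) : {set {ffun 'I_k -> {ffun 'I_b -> V}}} :=
  [set X : {ffun 'I_k -> {ffun 'I_b -> V}} | [forall i, injectiveb (X i)] &&
     [forall i, forall j, f (X i j) == s i]].

(** These are all labelled copies of K_k(b) in the complete k-partite graph on the colour classes,
    [s i] being the class that holds part i. *)
Definition rainbow := \bigcup_(s : {perm 'I_k}) rainbow_of s.

Lemma rainbow_ofP (s : {perm 'I_k}) (X : {ffun 'I_k -> {ffun 'I_b -> V}}) :
  reflect ((forall i, injective (X i)) /\ forall i j, f (X i j) = s i)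
          (X \in rainbow_of s).
Proof.
rewrite inE; apply: (iffP andP) => -[h1 h2]; split.
- by move=> i; apply/injectiveP; apply: (forallP h1).
- by move=> i j; apply/eqP; move: h2 => /forallP/(_ i)/forallP.
- by apply/forallP => i; apply/injectiveP.
- by apply/forallP => i; apply/forallP => j; apply/eqP.
Qed.

(** Since b > 0, the permutation can be read off from the copy, so the union is disjoint. For fixed
    s the parts are chosen independently. *)
Lemma card_rainbow : #|rainbow| = k`! * \prod_i #|colour_class i| ^_ b.
Proof.
rewrite -sum1_card partition_disjoint_bigcup => [|s t st]; last first.
  apply/pred0P => X /=; apply/negP => /andP[/rainbow_ofP[_ hs] /rainbow_ofP[_ ht]].
  case/eqP: st; apply/permP => i.
  by rewrite -(hs i (Ordinal b_gt0)) ht.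
rewrite (eq_bigr (fun=> \prod_i #|colour_class i| ^_ b)) => [|s _].
  by rewrite sum_nat_const -(card_Sn k).
rewrite sum1_card.
pose F i : {pred {ffun 'I_b -> V}} :=
  [pred y | (y \in ffun_on (mem (colour_class (s i)))) && injectiveb y].
transitivity #|(family F : {pred {ffun 'I_k -> {ffun 'I_b -> V}}})|.
  apply: eq_card => X; apply/rainbow_ofP/familyP => [[h1 h2] i|h].
    rewrite inE; apply/andP; split; last by apply/injectiveP.
    by apply/ffun_onP => j; rewrite inE h2.
  split=> i; first by have := h i; rewrite inE => /andP[_ /injectiveP].
  by move=> j; have := h i; rewrite inE => /andP[/ffun_onP/(_ j) + _]; rewrite inE => /eqP.
rewrite card_family foldrE big_map big_enum /= [RHS](reindex_inj (@perm_inj _ s)) /=.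
apply: eq_bigr => i _; rewrite -[in RHS](card_ord b).
have -> : #|colour_class (s i)| = #|mem (colour_class (s i))| by apply: eq_card.
by rewrite -card_inj_ffuns_on; apply: eq_card => y; rewrite !inE.
Qed.

Lemma embs_sub_rainbow (e : rel V) a : irreflexive e ->
  2 * a - 2 < b -> (forall v, #|colour_class (f v) :&: nbhd e v| < a) ->
  embs e k b \subset rainbow.
Proof.
move=> e_irr ab inner; apply/subsetP => X /embsP[Xinj Xe].
pose x (p : 'I_k * 'I_b) := X p.1 p.2.
have xinj : injective x.
  move=> [i j] [i' j']; rewrite /x /=; have [<- /Xinj->//|ii' E] := eqVneq i i'.
  by have := Xe _ _ ii' j j'; rewrite E e_irr.
pose P c := [set p | f (x p) == c]; pose row i := [set p : 'I_k * 'I_b | p.1 == i].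
have card_row i : #|row i| = b.
  rewrite -[RHS]card_ord -[RHS]cardsT -[RHS](card_imset _ (_ : injective (pair i))).
    apply: eq_card => -[i' j]; rewrite inE /=; apply/eqP/imsetP => [->|[j' _ [-> _]]//].
    by exists j.
  by move=> j j' [].
have P_row c p : p \in P c -> #|P c :\: row p.1| < a.
  rewrite inE => /eqP pc; apply: leq_ltn_trans (inner (x p)).
  rewrite -(card_imset _ xinj); apply: subset_leq_card; apply/subsetP => _ /imsetP[q qP ->].
  by move: qP; rewrite !inE pc => /andP[qp ->] /=; rewrite Xe // eq_sym.
(* Positions in different rows are adjacent, so fewer than a positions of P c lie outside the row of
   any of its members. If P c meets two rows, the two complements cover it and |P c| <= 2(a-1) <
   b. *)
have dichotomy c p : p \in P c -> #|P c| < b \/ P c \subset row p.1.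
  move=> pP; have [?|/subsetPn[q qP qp]] := boolP (P c \subset row p.1); [by right | left].
  rewrite inE in qp.
  have sub : P c \subset (P c :\: row p.1) :|: (P c :\: row q.1).
    apply/subsetP => r rP; rewrite in_setU !in_setD rP !andbT !(in_set (fun p => p.1 == _)).
    have [->|//] := eqVneq r.1 p.1; rewrite eq_sym qp orbT //.
  have := subset_leq_card sub; have := P_row _ _ pP; have := P_row _ _ qP.
  by rewrite cardsU; lia.
have P_le c : #|P c| <= b.
  have [->|/set0Pn[p pP]] := eqVneq (P c) set0; first by rewrite cards0.
  by case: (dichotomy c p pP) => [/ltnW//|/subset_leq_card]; rewrite card_row.
have P_sum : \sum_c #|P c| = k * b.
  rewrite -[in RHS](card_ord k) -[in RHS](card_ord b) -card_prod -sum1_card.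
  rewrite (partition_big (f \o x) xpredT) //=; apply: eq_bigr => c _.
  by rewrite -sum1_card; apply: eq_bigl => p; rewrite inE.
(* The k sets P c have at most b elements each and kb in total, so all are full, and each is then an
   entire row. *)
have P_eq c : #|P c| = b.
  apply/eqP; rewrite eqn_leq P_le /= leqNgt; apply/negP => lt.
  have : \sum_c #|P c| < k * b.
    rewrite -[in X in _ < X](card_ord k) -sum_nat_const (bigD1 c) //= [X in _ < X](bigD1 c) //=.
    by rewrite -addSn leq_add // leq_sum.
  by rewrite P_sum ltnn.
pose o := Ordinal b_gt0.
have Prow i : P (f (X i o)) = row i.
  have pP : (i, o) \in P (f (X i o)) by rewrite inE.
  case: (dichotomy _ _ pP); first by rewrite P_eq ltnn.
  by move=> /= sub; apply/eqP; rewrite eqEcard sub card_row P_eq leqnn.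
have sinj : injective (fun i => f (X i o)).
  move=> i i' E; have : (i', o) \in row i by rewrite -Prow inE E.
  by rewrite inE => /eqP.
apply/bigcupP; exists (perm sinj) => //; apply/rainbow_ofP; split=> // i j.
have : (i, j) \in P (f (X i o)) by rewrite Prow inE.
by rewrite inE permE => /eqP.
Qed.

Lemma rainbow_sub_embs (e : rel V) :
  (forall x y, f x != f y -> e x y) -> rainbow \subset embs e k b.
Proof.
move=> cross; apply/subsetP => X /bigcupP[s _ /rainbow_ofP[Xinj Xs]].
apply/embsP; split=> // i i' ii' j j'; apply: cross; rewrite !Xs.
by rewrite (inj_eq perm_inj).
Qed.

Lemma injection_into_class x :
  b <= #|colour_class (f x)| ->
  exists y : {ffun 'I_b -> V}, [/\ injective y, forall j, f (y j) = f x &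
     y (Ordinal b_gt0) = x].
Proof.
(* The class is listed with x in front, so that position 0 receives x. *)
move=> bx; pose s := x :: rem x (enum (colour_class (f x))).
have sp : perm_eq s (enum (colour_class (f x))).
  by rewrite perm_sym perm_to_rem // mem_enum inE.
have us : uniq s by rewrite (perm_uniq sp) enum_uniq.
have bs : b <= size s by rewrite (perm_size sp) -cardE.
have js (j : 'I_b) : j < size s by apply: leq_trans bs.
exists [ffun j : 'I_b => nth x s j]; split; last by rewrite ffunE.
- by move=> j j'; rewrite !ffunE => /eqP; rewrite nth_uniq // => /eqP/val_inj.
- move=> j; rewrite ffunE; have := mem_nth x (js j).
  by rewrite (perm_mem sp) mem_enum inE => /eqP.
Qed.

(** Vertices x and y of different colours extend to a system of representatives z, and each z i to b
    vertices of its class. The resulting rainbow copy has x and y in different parts, so they are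
    adjacent. *)
Lemma cross_edges_of_rainbow_sub (e : rel V) :
  (forall i, b <= #|colour_class i|) -> rainbow \subset embs e k b ->
  forall x y, f x != f y -> e x y.
Proof.
move=> large /subsetP sub x y xy.
have reps i : exists z, f z == i.
  have : 0 < #|colour_class i| by apply: leq_trans (large i).
  by case/card_gt0P => z; rewrite inE => zi; exists z.
pose z i := if i == f x then x else if i == f y then y else xchoose (reps i).
have fz i : f (z i) = i.
  by rewrite /z; case: eqP => [->//|_]; case: eqP => [->//|_]; apply/eqP/(xchooseP (reps i)).
have row i : exists X : {ffun 'I_b -> V}, injectiveb X && [forall j, f (X j) == i] && (X (Ordinal b_gt0) == z i).
  have [|X [X1 X2 X3]] := @injection_into_class (z i); first by rewrite fz large.
  exists X; rewrite X3 eqxx andbT; apply/andP; split; first exact/injectiveP.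
  by apply/forallP => j; rewrite X2 fz.
pose X := [ffun i => xchoose (row i)].
have /embsP[_ Xe] : X \in embs e k b.
  apply: sub; apply/bigcupP; exists 1%g => //; apply/rainbow_ofP; split=> i.
    by rewrite ffunE; have /andP[/andP[/injectiveP]] := xchooseP (row i).
  move=> j; rewrite ffunE perm1.
  by have /andP[/andP[_ /forallP/(_ j)/eqP]] := xchooseP (row i).
have Xz i : X i (Ordinal b_gt0) = z i.
  by rewrite ffunE; have /andP[_ /eqP] := xchooseP (row i).
have := Xe _ _ xy (Ordinal b_gt0) (Ordinal b_gt0); rewrite !Xz /z !eqxx.
by rewrite eq_sym (negbTE xy).
Qed.

End Rainbow.

(** * Balanced part sizes and products of falling factorials *)

Definition balanced k (s : 'I_k -> nat) := forall i j, s i <= (s j).+1.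

(** With b written as b+1, both sides share the factor (u-1)^_b * v^_b, which leaves u(v-b) <
    (u-1-b)(v+1). *)
Lemma ffact_smoothing u v b : 0 < b -> b <= v -> v.+1 < u ->
  u ^_ b * v ^_ b < u.-1 ^_ b * v.+1 ^_ b.
Proof.
case: b => // b _ bv vu.
rewrite (ffactnS u) (ffactnSr u.-1) (ffactnS v.+1) (ffactnSr v) /=.
have A0 : 0 < u.-1 ^_ b by rewrite ffact_gt0; lia.
have B0 : 0 < v ^_ b by rewrite ffact_gt0; lia.
have [x vE] : exists x, v = b + x by exists (v - b); lia.
have [y uE] : exists y, u = b + x + 2 + y by exists (u - (b + x + 2)); lia.
have lt : u * (v - b) < (u.-1 - b) * v.+1.
  have -> : v - b = x by lia.
  have -> : u.-1 - b = x + 1 + y by lia.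
  rewrite uE vE; nia.
have AB0 : 0 < u.-1 ^_ b * v ^_ b by rewrite muln_gt0 A0.
have := lt; rewrite -(ltn_pmul2l AB0); move: (u.-1 ^_ b) (v ^_ b) => A B; lia.
Qed.

Lemma perm_two_values (l : seq nat) q : (forall x, x \in l -> q <= x <= q.+1) ->
  perm_eq l (nseq (count (ltn q) l) q.+1 ++ nseq (size l - count (ltn q) l) q) /\
  sumn l = q * size l + count (ltn q) l.
Proof.
elim: l => [_|x l IH h] /=; first by rewrite muln0.
have [hx hl] : q <= x <= q.+1 /\ forall y, y \in l -> q <= y <= q.+1.
  by split=> [|y yl]; apply: h; rewrite inE ?eqxx ?yl ?orbT.
have [p ->] := IH hl; have cs := count_size (ltn q) l.
have [-> | ->] : x = q \/ x = q.+1 by lia.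
  rewrite ltnn add0n subSn //; split; last by lia.
  by rewrite /= perm_sym -[_ :: nseq _ _]/([:: q] ++ _) perm_catCA /= perm_cons perm_sym.
rewrite ltnSn add1n subSS; split; last by lia.
by rewrite /= perm_cons.
Qed.

(** A balanced sequence takes only the values q and q+1, q being its minimum. As q is attained,
    division of the sum by k recovers q and the number of entries q+1, so the sum determines the
    multiset of values. *)
Lemma balanced_perm k (s t : 'I_k -> nat) : balanced s -> balanced t ->
  \sum_i s i = \sum_i t i -> exists p : {perm 'I_k}, forall i, s (p i) = t i.
Proof.
case: k s t => [|k] s t bs bt st; first by exists 1%g => -[].
suff canonical (r : 'I_k.+1 -> nat) : balanced r ->
    perm_eq (codom r)
      (nseq ((\sum_i r i) %% k.+1) ((\sum_i r i) %/ k.+1).+1 ++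
       nseq (k.+1 - (\sum_i r i) %% k.+1) ((\sum_i r i) %/ k.+1)).
  have cs := canonical s bs; have ct := canonical t bt; rewrite -st in ct.
  have E (r : 'I_k.+1 -> nat) : [tuple r i | i < k.+1] = codom r :> seq nat.
    by rewrite codomE.
  have : perm_eq [tuple t i | i < k.+1] [tuple s i | i < k.+1].
    by rewrite !E (permPl ct) perm_sym.
  case/tuple_permP => p /val_inj tE; exists p => i.
  by have := congr1 (fun u => tnth u i) tE; rewrite !tnth_mktuple.
move=> br; set n := \sum_i r i.
have [i0 _ i0min] := @arg_minnP _ ord0 xpredT r isT.
have mem_r x : x \in codom r -> r i0 <= x <= (r i0).+1.
  by case/codomP => i ->; rewrite i0min // br.
have [p sE] := perm_two_values mem_r.
have sizer : size (codom r) = k.+1 by rewrite size_codom card_ord.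
rewrite sizer in sE p.
have nE : n = r i0 * k.+1 + count (ltn (r i0)) (codom r).
  by rewrite -sE sumnE codomE big_map big_enum.
have lt : count (ltn (r i0)) (codom r) < k.+1.
  have := count_predC (ltn (r i0)) (codom r); rewrite sizer.
  have : 0 < count (predC (ltn (r i0))) (codom r).
    by rewrite -has_count; apply/hasP; exists (r i0); rewrite ?codom_f //= ltnn.
  lia.
by rewrite nE divnMDl // modnMDl divn_small // modn_small // addn0.
Qed.

Lemma leq_prod_smoothing k b (s : 'I_k -> nat) i j : 0 < b -> (s j).+1 < s i ->
  (forall x, b <= s x) ->
  exists s' : 'I_k -> nat, [/\ \sum_x s' x = \sum_x s x,
    \sum_x s' x ^ 2 < \sum_x s x ^ 2 &
    \prod_x s x ^_ b < \prod_x s' x ^_ b].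
Proof.
move=> b0 ji large; have ij : j != i by apply: contraTneq ji => ->; rewrite ltnNge leqnSn.
pose s' x := if x == i then (s i).-1 else if x == j then (s j).+1 else s x.
have si : s' i = (s i).-1 by rewrite /s' eqxx.
have sj : s' j = (s j).+1 by rewrite /s' (negbTE ij) eqxx.
have sx x : x != i -> x != j -> s' x = s x by rewrite /s' => /negbTE-> /negbTE->.
exists s'; split.
- rewrite (bigD1 i) //= (bigD1 j) //= [RHS](bigD1 i) //= [X in _ = _ + X](bigD1 j) //= si sj.
  rewrite (eq_bigr s) => [|x /andP[xi xj]]; [lia | exact: sx].
- rewrite (bigD1 i) //= (bigD1 j) //= [X in _ < X](bigD1 i) //= [X in _ < _ + X](bigD1 j) //= si sj.
  rewrite (eq_bigr (fun x => s x ^ 2)) => [|x /andP[xi xj]]; last by rewrite sx.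
  rewrite !addnA ltn_add2r !expnS !expn0; nia.
rewrite (bigD1 i) //= (bigD1 j) //= [X in _ < X](bigD1 i) //= [X in _ < _ * X](bigD1 j) //= si sj.
rewrite [X in _ < _ * (_ * X)](eq_bigr (fun x => s x ^_ b)) => [|x /andP[xi xj]]; last by rewrite sx.
rewrite !mulnA ltn_pmul2r ?ffact_smoothing //.
by rewrite prodn_gt0 // => x; rewrite ffact_gt0.
Qed.

(** Induction on the sum of squares, which smoothing decreases while strictly increasing the
    product. A part smaller than b makes the product 0, and a balanced s is a permutation of t. *)
Lemma balanced_maximizes k b (s t : 'I_k -> nat) : 0 < b -> balanced t ->
  (forall x, b <= t x) -> \sum_x s x = \sum_x t x ->
  \prod_x s x ^_ b <= \prod_x t x ^_ b /\
  (\prod_x s x ^_ b = \prod_x t x ^_ b -> balanced s).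
Proof.
move=> b0 bt large; have [m] := ubnP (\sum_x s x ^ 2).
elim: m s => // m IH s sm st.
have t0 : 0 < \prod_x t x ^_ b by rewrite prodn_gt0 // => x; rewrite ffact_gt0.
have [[x sx]|sb] : (exists x, s x < b) \/ forall x, b <= s x.
  have [/existsP[x]|] := boolP [exists x, s x < b]; first by left; exists x.
  by rewrite negb_exists => /forallP h; right=> x; rewrite leqNgt.
- have -> : \prod_x s x ^_ b = 0 by rewrite (bigD1 x) //= ffact_small.
  by split=> // E; rewrite -E in t0.
have [bs|] := boolP [forall i, forall j, s i <= (s j).+1].
  have {}bs : balanced s by move=> i j; move/forallP: bs => /(_ i)/forallP.
  split=> //; have [p ps] := balanced_perm bs bt st.
  by rewrite (reindex_inj (@perm_inj _ p)) /= (eq_bigr _ (fun x _ => congr1 (fun y => y ^_ b) (ps x))).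
rewrite negb_forall => /existsP[i]; rewrite negb_forall => /existsP[j].
rewrite -ltnNge => ji; have [s' [sum' sq' lt']] := leq_prod_smoothing b0 ji sb.
have [|//|le _] := IH s'; first 2 last.
- have := leq_trans lt' le; move=> lt; split; first exact: ltnW.
  by move=> E; rewrite E ltnn in lt.
- exact: leq_trans sq' sm.
- by rewrite sum'.
Qed.

Lemma turan_part_balanced k n : balanced (@turan_part k n).
Proof. by move=> i j; rewrite /turan_part; case: (i < _); case: (j < _); lia. Qed.

Lemma sum_turan_part k n : 0 < k -> \sum_i @turan_part k n i = n.
Proof.
move=> k0; rewrite -[RHS](card_turan n k0) card_tagged sumnE big_map big_enum /=.
by apply: eq_bigr => i _; rewrite card_ord.
Qed.

(** * Deleting vertices *)

Definition turan_embs k b n := k`! * \prod_i @turan_part k n i ^_ b.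

Lemma turan_partS k n (i : 'I_k) : turan_part n.+1 i = turan_part n i + (i == n %% k :> nat).
Proof.
have k0 : 0 < k by apply: leq_ltn_trans (ltn_ord i).
have lt := ltn_pmod n k0; have ik := ltn_ord i; have nE := divn_eq n k.
rewrite /turan_part; have [lt'|ge] := ltnP (n %% k).+1 k.
  have -> : n.+1 %/ k = n %/ k.
    by rewrite [in LHS]nE -addnS divnMDl // (divn_small lt') addn0.
  have -> : n.+1 %% k = (n %% k).+1.
    by rewrite [in LHS]nE -addnS modnMDl (modn_small lt').
  by rewrite -addnA; congr (_ + _); lia.
have kE : (n %% k).+1 = k by lia.
have n1E : n.+1 = (n %/ k).+1 * k + 0 by rewrite [in LHS]nE -addnS kE mulSn; lia.
rewrite n1E divnMDl // div0n modnMDl mod0n; lia.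
Qed.

Lemma ffactSn n b : n.+1 ^_ b.+1 = n ^_ b.+1 + b.+1 * n ^_ b.
Proof.
rewrite ffactnS ffactnSr /=; have [nb|bn] := ltnP n b; first by rewrite ffact_small ?muln0.
by rewrite [b.+1 * _]mulnC -mulnDr mulnC; congr (_ * _); lia.
Qed.

(** The new vertex enlarges part n mod k, where the falling factorial grows by b times one of order
    b-1. With the other k-1 parts this leaves kb-1 factors, each at least n/k - b. *)
Lemma turan_embsS k b n : 0 < k -> 0 < b ->
  k`! * b * (n %/ k - b) ^ (k * b).-1 + turan_embs k b n <= turan_embs k b n.+1.
Proof.
move=> k0; case: b => // b _; rewrite /turan_embs -mulnA -mulnDr leq_mul2l; apply/orP; right.
pose i1 := Ordinal (ltn_pmod n k0); rewrite (bigD1 i1) //= [X in _ <= X](bigD1 i1) //=.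
rewrite turan_partS eqxx addn1 ffactSn mulnDl.
rewrite [X in _ <= _ * X + _ * X](eq_bigr (fun i => turan_part n i ^_ b.+1)) => [|i ne]; last first.
  by rewrite turan_partS -val_eqE /= in ne *; rewrite (negbTE ne) addn0.
rewrite addnC leq_add2l -mulnA leq_mul2l /=.
have part_ge i : n %/ k <= @turan_part k n i by rewrite leq_addr.
have -> : (k * b.+1).-1 = b + b.+1 * k.-1 by rewrite -[in LHS](prednK k0); lia.
rewrite expnD leq_mul //.
  apply: leq_trans (leq_expn_ffact _ _); apply: leq_expn2r.
  by have := part_ge i1; lia.
rewrite expnM -[in k.-1](card_ord k) -(cardC1 i1) -prod_nat_const.
apply: leq_prod => i _; apply: leq_trans (leq_expn_ffact _ _); apply: leq_expn2r.
by have := part_ge i; lia.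
Qed.

Section Deletion.

Variables (V : finType) (e : rel V) (v : V).

Definition del_rel : rel {x : V | x != v} := relpre val e.

Lemma card_del : #|{: {x : V | x != v}}| = #|V|.-1.
Proof. by rewrite card_sig -(cardC1 v); apply: eq_card. Qed.

Lemma embs_del k b :
  #|embs e k b| <= #|embs_at e k b v| + #|embs del_rel k b|.
Proof.
rewrite -(cardsID (embs_at e k b v)) leq_add //.
  exact/subset_leq_card/subsetIr.
pose F (Y : {ffun 'I_k -> {ffun 'I_b -> {x : V | x != v}}}) :
  {ffun 'I_k -> {ffun 'I_b -> V}} := [ffun i => [ffun j => val (Y i j)]].
apply: leq_trans (leq_imset_card F (embs del_rel k b)).
apply: subset_leq_card; apply/subsetP => X; rewrite !inE => /andP[nX XE].
rewrite XE /= in nX; have /embsP[Xi Xe] : X \in embs e k b by rewrite inE.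
have ne i j : X i j != v.
  apply: contraNneq nX => E; apply/existsP; exists i.
  by apply/existsP; exists j; apply/eqP.
apply/imsetP; exists [ffun i => [ffun j => exist (fun x => x != v) (X i j) (ne i j)]].
  apply/embsP; split=> [i j j'|i i' ii' j j']; rewrite !ffunE.
    by case=> /Xi.
  exact: Xe.
by apply/ffunP => i; apply/ffunP => j; rewrite !ffunE.
Qed.

Lemma join_free_del a k : join_free e a k -> join_free del_rel a k.
Proof.
move=> Ffree w T Tc Tw Ta; apply: (Ffree (val w) (fun i => val @: T i)).
- by move=> i j ij _ _ /imsetP[x xT ->] /imsetP[y yT ->]; apply: (Tc i j).
- move=> i; apply/subsetP => _ /imsetP[x xT ->].
  by move/subsetP: (Tw i) => /(_ x xT); rewrite !inE.
- by move=> i; rewrite card_imset //; apply: val_inj.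
Qed.

End Deletion.

(** All copies are rainbow, and rainbow copies are most numerous for balanced classes. Equality
    forces equality in both comparisons. *)
Lemma embs_le_of_colouring (V : finType) (e : rel V) a b k (f : V -> 'I_k) :
  irreflexive e -> 0 < b -> 2 * a - 2 < b -> 0 < k -> k * b <= #|V| ->
  (forall v, #|colour_class f (f v) :&: nbhd e v| < a) ->
  #|embs e k b| <= turan_embs k b #|V| /\
  (#|embs e k b| = turan_embs k b #|V| ->
    rainbow b f \subset embs e k b /\ balanced (fun i => #|colour_class f i|)).
Proof.
move=> e_irr b0 ab k0 Vb inner; have sub := embs_sub_rainbow b0 e_irr ab inner.
have sumV : \sum_i #|colour_class f i| = \sum_i @turan_part k #|V| i.
  rewrite sum_turan_part // -sum1_card (partition_big f xpredT) //=.
  by apply: eq_bigr => i _; rewrite -sum1_card; apply: eq_bigl => x; rewrite inE.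
have large x : b <= @turan_part k #|V| x.
  by apply: leq_trans (leq_addr _ _); rewrite leq_divRL // mulnC.
have [le eqb] := balanced_maximizes b0 (@turan_part_balanced k #|V|) large sumV.
have le' : #|rainbow b f| <= turan_embs k b #|V| by rewrite card_rainbow // leq_mul2l le orbT.
split; first exact: leq_trans (subset_leq_card sub) le'.
move=> E; have E' : #|rainbow b f| = turan_embs k b #|V|.
  by apply/eqP; rewrite eqn_leq le' -E subset_leq_card.
split.
  have /eqP -> : embs e k b == rainbow b f by rewrite eqEcard sub E E' leqnn.
  exact: subxx.
apply: eqb; apply/eqP; rewrite -(eqn_pmul2l (fact_gt0 k)) -card_rainbow //.
exact/eqP.
Qed.

(** Deleting a vertex in few copies raises the excess over the Turán count by at least 1. The excess
    on n1 vertices is at most C, so a positive excess is impossible from n1 + C vertices on. *)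
Lemma join_free_extremal a b k : 0 < a -> 0 < b -> 0 < k -> 2 * a - 2 < b ->
  exists n0, forall (V : finType) (e : rel V), symmetric e -> irreflexive e ->
    n0 <= #|V| -> join_free e a k ->
    #|embs e k b| <= turan_embs k b #|V| /\
    (#|embs e k b| = turan_embs k b #|V| ->
      exists f : V -> 'I_k, rainbow b f \subset embs e k b /\
        balanced (fun i => #|colour_class f i|)).
Proof.
move=> a0 b0 k0 ab; have [D [na [D0 hna]]] := min_degree_colouring a0 k0.
have [nb hnb] := min_degree_of_min_copies a b0 k0 D0.
pose n1 := maxn (maxn na nb) (maxn 1 (k * b)).
(* Either every vertex lies in enough copies for the minimum degree, hence for a colouring, or some
   vertex lies in fewer copies than the Turán increment. *)
have dichotomy (V : finType) (e : rel V) : symmetric e -> irreflexive e ->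
    n1 <= #|V| -> join_free e a k ->
    (exists f : V -> 'I_k, forall v, #|colour_class f (f v) :&: nbhd e v| < a) \/
    (exists v, #|embs e k b| + turan_embs k b #|V|.-1
               < turan_embs k b #|V| + #|embs (del_rel e (v := v)) k b|).
  move=> e_sym e_irr; rewrite !geq_max => /andP[/andP[aV bV] /andP[V0 _]] Ffree.
  have [/existsP[v low]|] := boolP [exists v,
      #|embs_at e k b v| < k`! * b * (#|V|.-1 %/ k - b) ^ (k * b).-1].
    right; exists v; have := turan_embsS #|V|.-1 k0 b0; have := embs_del e v k b.
    by rewrite prednK //; lia.
  rewrite negb_exists => /forallP copies; left.
  apply: hna => // v; apply: (hnb V e e_sym e_irr bV Ffree).
  by rewrite leqNgt.
have n1_large n : n1 <= n -> k * b <= n by rewrite geq_max => /andP[_]; rewrite geq_max => /andP[].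
pose C := (n1 ^ b) ^ k.
(* C bounds the number of labelled copies at n = n1. *)
have progress n : n1 <= n -> forall (V : finType) (e : rel V), symmetric e -> irreflexive e ->
    #|V| = n -> join_free e a k ->
    #|embs e k b| <= turan_embs k b n \/
    #|embs e k b| + (n - n1) <= turan_embs k b n + C.
  elim: n => [|n IH] n1n V e e_sym e_irr Vn Ffree.
    by move: n1n; rewrite leqNgt; case/negP; rewrite /n1; lia.
  have [nlt|nge] := ltnP n n1.
    have n1E : n1 = n.+1 by lia.
    right; rewrite n1E subnn addn0; apply: leq_trans (leq_addl _ _).
    apply: leq_trans (max_card _) _; rewrite !card_ffun !card_ord Vn /C.
    by rewrite -n1E.
  have [|[f inner]|[v lt]] := dichotomy V e e_sym e_irr _ Ffree; first by rewrite Vn.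
    have [|le _] := embs_le_of_colouring e_irr b0 ab k0 _ inner; first by rewrite Vn n1_large.
    by left; rewrite -Vn.
  have sym' : symmetric (del_rel e (v := v)) by move=> x y; apply: e_sym.
  have irr' : irreflexive (del_rel e (v := v)) by move=> x; apply: e_irr.
  have card' : #|{: {x : V | x != v}}| = n by rewrite card_del Vn.
  have [le|le] := IH nge _ _ sym' irr' card' (join_free_del Ffree).
    left; rewrite Vn in lt; have := leq_trans lt (leq_add (leqnn _) le).
    by rewrite ltn_add2r => /ltnW.
  right; rewrite Vn /= in lt; rewrite subSn // addnS.
  move: lt le; move: #|embs _ k b| #|embs e k b| (turan_embs _ _ _) (turan_embs _ _ _) (n - n1).
  by move=> x y z t d; clear; lia.
have n1_pos : 0 < n1 by rewrite /n1; lia.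
have upper (V : finType) (e : rel V) : symmetric e -> irreflexive e ->
    n1 + C <= #|V| -> join_free e a k -> #|embs e k b| <= turan_embs k b #|V|.
  move=> e_sym e_irr le Ffree.
  by have [||] := progress #|V| _ V e e_sym e_irr erefl Ffree; lia.
(* The extra 1 makes [upper] available after one deletion: in the case of equality, a vertex in few
   copies would leave a smaller graph above its Turán count. *)
exists (n1 + C).+1 => V e e_sym e_irr Vn Ffree; split; first by apply: upper => //; apply: ltnW.
move=> E; have n1V : n1 <= #|V| by lia.
have [[f inner]|[v lt]] := dichotomy V e e_sym e_irr n1V Ffree.
  have [_ h] := embs_le_of_colouring e_irr b0 ab k0 (n1_large _ n1V) inner.
  by exists f; apply: h.
have sym' : symmetric (del_rel e (v := v)) by move=> x y; apply: e_sym.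
have irr' : irreflexive (del_rel e (v := v)) by move=> x; apply: e_irr.
have := upper _ _ sym' irr' _ (join_free_del Ffree); rewrite card_del => h.
have := h _; move: lt; rewrite E; lia.
Qed.

(** * Labelled and unlabelled copies *)

Section Copies.

Variables (V W : finType) (H : sgraph W) (G : sgraph V).
Implicit Types (f : {ffun W -> V}) (S : {set V} * sgraph V).

Definition homs : {set {ffun W -> V}} :=
  [set f : {ffun W -> V} | injectiveb f &&
     [forall x, forall y, adj H x y ==> adj G (f x) (f y)]].

Definition auts : {set {ffun W -> W}} :=
  [set s : {ffun W -> W} | injectiveb s &&
     [forall x, forall y, adj H x y == adj H (s x) (s y)]].

Lemma auts_gt0 : 0 < #|auts|.
Proof.
apply/card_gt0P; exists [ffun x => x]; rewrite inE; apply/andP; split.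
  by apply/injectiveP => x y; rewrite !ffunE.
by apply/forallP => x; apply/forallP => y; rewrite !ffunE.
Qed.

(* The conjunct p.1 != p.2 makes the image a simple graph even for a
   non-injective f. *)
Definition image_edges f : {set V * V} :=
  [set p | (p.1 != p.2) &&
     [exists x, exists y, [&& adj H x y, p.1 == f x & p.2 == f y]]].

Lemma image_edgesP f u v : injective f ->
  reflect (exists x y, [/\ adj H x y, u = f x & v = f y]) ((u, v) \in image_edges f).
Proof.
move=> finj; rewrite inE /=; apply: (iffP andP) => [[_]|[x [y [xy -> ->]]]].
  by case/existsP=> x /existsP[y /and3P[xy /eqP-> /eqP->]]; exists x, y.
split; first by rewrite (inj_eq finj); apply: contraTneq xy => ->; rewrite adj_irrefl.
by apply/existsP; exists x; apply/existsP; exists y; rewrite xy !eqxx.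
Qed.

Lemma image_is_sgraph f : is_sgraph (image_edges f).
Proof.
apply/andP; split; apply/forallP => u; first by rewrite inE eqxx.
apply/forallP => v; rewrite !inE /= [v == u]eq_sym; apply/eqP; congr (_ && _).
by apply/existsP/existsP => -[x /existsP[y /and3P[xy ux vy]]];
  exists y; apply/existsP; exists x; rewrite adj_sym xy ux vy.
Qed.

Definition image_copy f : {set V} * sgraph V :=
  ([set f x | x : W], SGraph (image_is_sgraph f)).

Lemma adj_image_copy f x y : injective f ->
  adj (image_copy f).2 (f x) (f y) = adj H x y.
Proof.
move=> finj; apply/(image_edgesP _ _ finj)/idP => [[x' [y' [xy /finj-> /finj->]]]//|xy].
by exists x, y.
Qed.

Lemma sgraph_ext (G1 G2 : sgraph V) : adj G1 =2 adj G2 -> G1 = G2.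
Proof. by move=> E; apply/val_inj/setP => -[x y]; apply: E. Qed.

(** Fix one isomorphism f0 from H onto S. The embeddings with image S are exactly the composites of
    f0 with automorphisms of H. *)
Lemma homs_fiber S : is_subgraph G S -> subgraph_iso H S ->
  #|[set f in homs | image_copy f == S]| = #|auts|.
Proof.
move=> SG /existsP[f0 /and3P[/injectiveP f0inj /eqP f0S /forallP f0adj]].
have {}f0adj x y : adj S.2 (f0 x) (f0 y) = adj H x y.
  by have /forallP/(_ y)/eqP := f0adj x.
pose comp (s : {ffun W -> W}) : {ffun W -> V} := [ffun x => f0 (s x)].
have comp_inj : injective comp.
  move=> s t /ffunP E; apply/ffunP => x; apply: f0inj.
  by have := E x; rewrite !ffunE.
rewrite -(card_imset _ comp_inj); apply: eq_card => f; rewrite inE.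
apply/andP/imsetP => [[]|[s sA ->]].
  rewrite inE => /andP[/injectiveP finj _] /eqP fS.
  have ex x : exists y, f0 y == f x.
    have : f x \in S.1 by rewrite -fS imset_f.
    by rewrite -f0S => /imsetP[y _ ->]; exists y.
  pose s := [ffun x => xchoose (ex x)].
  have sE x : f0 (s x) = f x by rewrite ffunE; apply/eqP/(xchooseP (ex x)).
  exists s; last by apply/ffunP => x; rewrite ffunE sE.
  rewrite inE; apply/andP; split.
    by apply/injectiveP => x y E; apply: finj; rewrite -!sE E.
  apply/forallP => x; apply/forallP => y.
  by rewrite -[adj H (s x) _]f0adj !sE -fS adj_image_copy.
move: sA; rewrite inE => /andP[/injectiveP sinj /forallP sadj].
have {}sadj x y : adj H (s x) (s y) = adj H x y.
  by have /forallP/(_ y)/eqP := sadj x.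
have cE x : comp s x = f0 (s x) by rewrite ffunE.
have cinj : injective (comp s) by move=> x y; rewrite !cE => /f0inj/sinj.
have [s' sK s'K] := injF_bij sinj.
have SGP x y : adj S.2 x y -> [/\ x \in S.1, y \in S.1 & adj G x y].
  by move=> xy; have /forallP/(_ x)/forallP/(_ y)/implyP/(_ xy)/and3P := SG.
split.
  rewrite inE; apply/andP; split; first exact/injectiveP.
  apply/forallP => x; apply/forallP => y; apply/implyP => xy.
  by rewrite !cE; have [] := SGP (f0 (s x)) (f0 (s y)); rewrite ?f0adj ?sadj.
rewrite (surjective_pairing S) xpair_eqE; apply/andP; split.
  rewrite -f0S; apply/eqP/setP => u; apply/imsetP/imsetP => -[x _ ->].
    by exists (s x); rewrite ?cE.
  by exists (s' x); rewrite // cE s'K.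
apply/eqP/sgraph_ext => u v; apply/(image_edgesP _ _ cinj)/idP => [[x [y [xy -> ->]]]|uv].
  by rewrite !cE f0adj sadj.
have [] := SGP u v uv; rewrite -f0S => /imsetP[x _ ux] /imsetP[y _ vy] _.
exists (s' x), (s' y); rewrite !cE !s'K; split=> //.
by rewrite -sadj !s'K -f0adj -ux -vy.
Qed.

Lemma card_homs : #|homs| = num_copies H G * #|auts|.
Proof.
rewrite -sum1_card (partition_big image_copy
  (fun S => is_subgraph G S && subgraph_iso H S)) /=; last first.
  move=> f; rewrite inE => /andP[/injectiveP finj /forallP fadj]; apply/andP; split.
    apply/forallP => u; apply/forallP => v; apply/implyP.
    case/(image_edgesP _ _ finj) => x [y [xy -> ->]]; rewrite !imset_f //=.
    by have /forallP/(_ y)/implyP := fadj x; apply.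
  apply/existsP; exists f; apply/and3P; split=> //; first exact/injectiveP.
  by apply/forallP => x; apply/forallP => y; rewrite adj_image_copy.
rewrite (eq_bigr (fun=> #|auts|)) => [|S /andP[SG SH]].
  by rewrite sum_nat_cond_const.
by rewrite -(homs_fiber SG SH) -sum1_card; apply: eq_bigl => f; rewrite [RHS]inE.
Qed.

End Copies.

(** * The graphs of the theorem: copies of H, the forbidden graph, Turán graphs *)

Notation equipartite k b := (complete_multipartite (fun _ : 'I_k => b)).

Lemma card_homs_equipartite (V : finType) (G : sgraph V) k b : 0 < b ->
  #|homs (equipartite k b) G| = #|embs (adj G) k b|.
Proof.
move=> b0; pose T := {i : 'I_k & 'I_b}.
pose curry_hom (f : {ffun T -> V}) : {ffun 'I_k -> {ffun 'I_b -> V}} :=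
  [ffun i => [ffun j => f (existT (fun=> 'I_b) i j)]].
have curryE f i j : curry_hom f i j = f (existT (fun=> 'I_b) i j) by rewrite !ffunE.
have curry_inj : injective curry_hom.
  move=> f g E; apply/ffunP => -[i j].
  by rewrite -!curryE E.
rewrite -(card_imset _ curry_inj); apply: eq_card => X.
apply/imsetP/embsP => [[f]|[Xinj Xe]].
  rewrite inE => /andP[/injectiveP finj /forallP fadj] ->; split=> [i j j'|i i' ii' j j'].
    by rewrite !curryE => /finj/eqP; rewrite eq_Tagged => /eqP.
  rewrite !curryE; have /forallP/(_ (existT (fun=> 'I_b) i' j'))/implyP := fadj (existT (fun=> 'I_b) i j).
  by apply; rewrite /adj inE.
exists [ffun p : T => X (tag p) (tagged p)]; last first.
  by apply/ffunP => i; apply/ffunP => j; rewrite curryE ffunE.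
rewrite inE; apply/andP; split.
  apply/injectiveP => -[i j] [i' j']; rewrite !ffunE /=.
  have [<- /Xinj->//|/Xe h E] := eqVneq i i'.
  by have := h j j'; rewrite E adj_irrefl.
apply/forallP => p; apply/forallP => q; apply/implyP.
rewrite /adj inE /= !ffunE => pq; exact: (Xe _ _ pq (tagged p) (tagged q)).
Qed.

Definition coned_multipartite a k :=
  complete_multipartite (fun i : 'I_k.+1 => if i == ord0 then 1 else a).

(** The apex goes to v, and part [lift ord0 i] to an enumeration of T i. Vertices from different
    parts have adjacent images, which are therefore distinct. *)
Lemma join_free_of_not_contains (V : finType) (G : sgraph V) a k :
  ~~ contains G (coned_multipartite a k) -> join_free (adj G) a k.
Proof.
move=> /negP noF v T Tc Tv Ta; apply: noF.
pose sz (i : 'I_k.+1) := if i == ord0 then 1 else a.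
pose g (p : {i : 'I_k.+1 & 'I_(sz i)}) : V :=
  if unlift ord0 (tag p) is Some j then nth v (enum (T j)) (tagged p) else v.
have gT i (j : 'I_(sz (lift ord0 i))) : g (Tagged (fun i => 'I_(sz i)) j) = nth v (enum (T i)) j.
  by rewrite /g /= liftK.
have lt_sz i (j : 'I_(sz (lift ord0 i))) : j < size (enum (T i)).
  by rewrite -cardE Ta; apply: leq_trans (ltn_ord j) _; rewrite /sz.
have gin i (j : 'I_(sz (lift ord0 i))) : g (Tagged (fun i => 'I_(sz i)) j) \in T i.
  by rewrite gT -mem_enum mem_nth.
have g0 (j : 'I_(sz ord0)) : g (Tagged (fun i => 'I_(sz i)) j) = v.
  by rewrite /g /= unlift_none.
have gadj p q : tag p != tag q -> adj G (g p) (g q).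
  case: p q => [i j] [i' j'] /=.
  case: (unliftP ord0 i) j => [i1|] -> j; case: (unliftP ord0 i') j' => [i1'|] -> j'.
  - by rewrite (inj_eq lift_inj) => ne; apply: Tc ne _ _ (gin _ _) (gin _ _).
  - move=> _; rewrite adj_sym g0; have := subsetP (Tv i1) _ (gin _ j).
    by rewrite inE.
  - by move=> _; rewrite g0; have := subsetP (Tv i1') _ (gin _ j'); rewrite inE.
  - by rewrite eqxx.
apply/existsP; exists [ffun p => g p]; apply/andP; split.
  apply/injectiveP => p q; rewrite !ffunE => E.
  have : tag p == tag q.
    by apply: contraT => /gadj; rewrite E adj_irrefl.
  case: p q E => [i j] [i' j'] /= E /eqP ii'; case: _ / ii' j' E => j'.
  case: (unliftP ord0 i) j j' => [i1|] -> j j'.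
    rewrite !gT => /eqP; rewrite nth_uniq ?enum_uniq ?lt_sz // => /eqP E.
    by congr existT; apply: val_inj.
  move=> _; congr existT; apply: val_inj.
  by case: j j' => [[|?] ?] [[|?] ?].
by apply/forallP => p; apply/forallP => q; rewrite !ffunE /adj inE; apply/implyP/gadj.
Qed.

(** As a > 0, one vertex from each of the k+1 parts gives a clique, whose colours are distinct. *)
Lemma coned_multipartite_colour_bound a k m
    (c : {i : 'I_k.+1 & 'I_(if i == ord0 then 1 else a)} -> 'I_m) : 0 < a ->
  (forall x y, adj (coned_multipartite a k) x y -> c x != c y) -> k < m.
Proof.
move=> a0 hc; pose sz (i : 'I_k.+1) := if i == ord0 then 1 else a.
have sz0 i : 0 < sz i by rewrite /sz; case: ifP.
pose pt i : {i : 'I_k.+1 & 'I_(sz i)} := Tagged (fun i => 'I_(sz i)) (Ordinal (sz0 i)).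
have inj : injective (fun i => c (pt i)).
  move=> i j E; apply/eqP; apply: contraT => ij.
  by have := hc (pt i) (pt j); rewrite E eqxx; apply; rewrite /adj inE.
by have := leq_card _ inj; rewrite !card_ord.
Qed.

Lemma chromatic_number_coned a k : 0 < a ->
  chromatic_number (coned_multipartite a k) = k.+1.
Proof.
move=> a0; rewrite /chromatic_number; case: ex_minnP => m /existsP[c /forallP hc] hmin.
apply/eqP; rewrite eqn_leq; apply/andP; split.
  apply: hmin; apply/existsP; exists [ffun p => tag p].
  apply/forallP => x; apply/forallP => y; apply/implyP.
  by rewrite /adj inE !ffunE.
apply: (@coned_multipartite_colour_bound a k m c a0) => x y xy.
by have /forallP/(_ y)/implyP := hc x; apply.
Qed.

Lemma not_contains_coned (V : finType) (G : sgraph V) a k (c : V -> 'I_k) : 0 < a ->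
  (forall x y, adj G x y -> c x != c y) -> ~~ contains G (coned_multipartite a k).
Proof.
move=> a0 hc; apply/negP => /existsP[f /andP[_ /forallP fadj]].
suff : k < k by rewrite ltnn.
apply: (@coned_multipartite_colour_bound a k k (fun x => c (f x)) a0) => x y xy.
by apply: hc; have /forallP/(_ y)/implyP := fadj x; apply.
Qed.

Lemma card_embs_multipartite_colouring (V : finType) (G : sgraph V) k b (f : V -> 'I_k) n :
  0 < b -> (forall x y, adj G x y = (f x != f y)) ->
  (forall i, #|colour_class f i| = turan_part n i) ->
  #|embs (adj G) k b| = turan_embs k b n.
Proof.
move=> b0 fE cE.
have -> : embs (adj G) k b = rainbow b f.
  apply/eqP; rewrite eqEsubset rainbow_sub_embs => [|x y]; last by rewrite fE.
  (* Colour classes are independent here, so a = 1 applies and its size condition is 0 < b. *)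
  rewrite andbT; apply: (embs_sub_rainbow (a := 1) b0) => // [x|v].
    exact: adj_irrefl.
  rewrite ltnS leqn0 cards_eq0; apply/eqP/setP => w; rewrite !inE fE eq_sym.
  by case: eqP.
by rewrite card_rainbow // /turan_embs; congr (_ * _); apply: eq_bigr => i _; rewrite cE.
Qed.

Lemma card_turan_class k n i :
  #|colour_class (fun p : {i : 'I_k & 'I_(turan_part n i)} => tag p) i| = turan_part n i.
Proof.
rewrite -[RHS]card_ord -(card_imset predT (_ : injective (fun j : 'I_(turan_part n i) =>
   existT (fun i => 'I_(@turan_part k n i)) i j))); last first.
  by move=> j j' /eqP; rewrite eq_Tagged => /eqP.
apply: eq_card => -[i' j]; rewrite inE /=; apply/eqP/imsetP => [E|[j' _ /(congr1 (@tag _ _))//]].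
by case: _ / E j => j; exists j.
Qed.

(** [ex] ranges over graphs on ['I_n], so the Turán graph is transported there by an enumeration of
    its vertices. *)
Lemma turan_ord k n : 0 < k -> exists (G : sgraph 'I_n) (f : 'I_n -> 'I_k),
  (forall x y, adj G x y = (f x != f y)) /\
  forall i, #|colour_class f i| = turan_part n i.
Proof.
move=> k0; pose g (x : 'I_n) := enum_val (cast_ord (esym (card_turan n k0)) x).
pose f x := tag (g x).
have gP : is_sgraph [set p | f p.1 != f p.2].
  apply/andP; split; apply/forallP => x; first by rewrite inE eqxx.
  by apply/forallP => y; rewrite !inE /= [f y == _]eq_sym.
exists (SGraph gP), f; split=> [x y|i]; first by rewrite /adj inE.
have ginj : injective g by move=> x y /enum_val_inj/cast_ord_inj.
rewrite -(card_turan_class n i) -(card_imset _ ginj).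
apply: eq_card => p; rewrite inE; apply/imsetP/eqP => [[x xf ->]|pi].
  by move: xf; rewrite inE => /eqP.
exists (cast_ord (card_turan n k0) (enum_rank p)).
  by rewrite inE /f /g cast_ordK enum_rankK pi.
by rewrite /g cast_ordK enum_rankK.
Qed.

Lemma contains_turan (V : finType) (G : sgraph V) k (f : V -> 'I_k) n (p : {perm 'I_k}) :
  (forall x y, f x != f y -> adj G x y) ->
  (forall i, #|colour_class f (p i)| = turan_part n i) ->
  contains G (turan_graph k n).
Proof.
move=> cross cp; pose T := {i : 'I_k & 'I_(turan_part n i)}.
have ex (q : T) : exists x, x \in colour_class f (p (tag q)).
  by apply/card_gt0P; rewrite cp; apply: leq_ltn_trans (ltn_ord (tagged q)).
pose g (q : T) := nth (xchoose (ex q)) (enum (colour_class f (p (tag q)))) (tagged q).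
have lt (q : T) : tagged q < size (enum (colour_class f (p (tag q)))).
  by rewrite -cardE cp.
have fg q : f (g q) = p (tag q).
  by have := mem_nth (xchoose (ex q)) (lt q); rewrite mem_enum inE => /eqP.
have gadj q q' : tag q != tag q' -> adj G (g q) (g q').
  by move=> qq'; apply: cross; rewrite !fg (inj_eq perm_inj).
apply/existsP; exists [ffun q => g q]; apply/andP; split; last first.
  by apply/forallP => q; apply/forallP => q'; rewrite !ffunE /adj inE; apply/implyP/gadj.
apply/injectiveP => q q'; rewrite !ffunE => E.
have : tag q == tag q' by apply: contraT => /gadj; rewrite E adj_irrefl.
case: q q' E => [i j] [i' j'] /= E /eqP ii'; case: _ / ii' j' E => j'.
rewrite /g /= (set_nth_default (xchoose (ex (existT _ i j))) _ (lt (existT _ i j'))) => /eqP.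
rewrite nth_uniq ?enum_uniq ?(lt (existT _ i j)) ?(lt (existT _ i j')) // => /eqP E.
by congr existT; apply: val_inj.
Qed.

Theorem theorem3p3 (a b k : nat) (ha : 0 < a) (hb : 0 < b) (hk : 0 < k)
    (hab : 2 * a - 2 < b) :
  let H := complete_multipartite (fun _ : 'I_k => b) in
  let F := complete_multipartite
             (fun i : 'I_k.+1 => if i == ord0 then 1 else a) in
  turan_good H F /\
  exists n0 : nat, forall n : nat, n0 <= n ->
    forall G : sgraph 'I_n, ~~ contains G F ->
      num_copies H G = ex n H F -> contains G (turan_graph k n).
Proof.
move=> H F; have [n1 extremal] := join_free_extremal ha hb hk hab.
have A0 := auts_gt0 H.
have copiesE (V : finType) (G : sgraph V) :
    num_copies H G * #|auts H| = #|embs (adj G) k b|.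
  by rewrite -card_homs card_homs_equipartite.
have turanE n : num_copies H (turan_graph k n) * #|auts H| = turan_embs k b n.
  rewrite copiesE; apply: (card_embs_multipartite_colouring (f := fun p => tag p)) => //.
    by move=> x y; rewrite /adj inE.
  exact: card_turan_class.
have bound n (G : sgraph 'I_n) : n1 <= n -> ~~ contains G F ->
    num_copies H G <= num_copies H (turan_graph k n) /\
    (num_copies H G = num_copies H (turan_graph k n) ->
      exists f : 'I_n -> 'I_k, rainbow b f \subset embs (adj G) k b /\
        balanced (fun i => #|colour_class f i|)).
  move=> n1n noF.
  have [|le eqE] := extremal _ (adj G) (@adj_sym _ G) (@adj_irrefl _ G) _
    (join_free_of_not_contains noF); first by rewrite card_ord.
  rewrite card_ord in le eqE; split; last first.
    by move=> E; apply: eqE; rewrite -turanE -E copiesE.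
  by rewrite -(leq_pmul2r A0) copiesE turanE.
have exE n : n1 <= n -> ex n H F = num_copies H (turan_graph k n).
  move=> n1n; apply/eqP; rewrite eqn_leq; apply/andP; split.
    by apply/bigmax_leqP => G noF; have [] := bound n G n1n noF.
  have [G [f [fE cE]]] := turan_ord n hk.
  have noF : ~~ contains G F.
    by apply: (not_contains_coned (c := f) ha) => x y; rewrite fE.
  apply: (@leq_trans (num_copies H G)); last first.
    exact: (@leq_bigmax_cond _ (fun G => ~~ contains G F) (num_copies H) G noF).
  rewrite -(leq_pmul2r A0) turanE copiesE.
  by rewrite (card_embs_multipartite_colouring hb fE cE).
split.
  rewrite /turan_good (chromatic_number_coned k ha) subn1 /=; split=> //.
    by apply: (not_contains_coned (c := fun p => tag p) ha) => x y; rewrite /adj inE.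
  by exists n1.
(* n >= kb ensures that every class has at least b vertices, so that each pair of vertices of
   different colours lies in a rainbow copy. *)
exists (maxn n1 (k * b)) => n; rewrite geq_max => /andP[n1n kbn] G noF E.
have [_] := bound n G n1n noF; rewrite -exE // => /(_ E)[f [sub bal]].
have sumE : \sum_i #|colour_class f i| = \sum_i @turan_part k n i.
  rewrite sum_turan_part // -[RHS](card_ord n) -sum1_card (partition_big f xpredT) //=.
  by apply: eq_bigr => i _; rewrite -sum1_card; apply: eq_bigl => x; rewrite inE.
have [p pE] := balanced_perm bal (@turan_part_balanced k n) sumE.
apply: (contains_turan (p := p) _ pE); apply: (cross_edges_of_rainbow_sub hb) sub => i.
have -> : #|colour_class f i| = @turan_part k n (p^-1%g i) by rewrite -pE permKV.
by apply: leq_trans (leq_addr _ _); rewrite leq_divRL // mulnC.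
Qed.
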